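(* Let $K\in\mathcal T_H$, let $v\in H^1(\mathcal T_H)$ be such that $\operatorname{supp}v\subset K$, and let $\tilde\mu_h^f=Pv$. Then, for any integer $j\ge1$, $$|T\tilde\mu_h^f|_{H_{\mathcal A}^1(\mathcal T_H\setminus\mathcal T_{j+1}(K))}^2\le e^{-\frac{j}{1+N^f\alpha}}\,|T\tilde\mu_h^f|_{H_{\mathcal A}^1(\mathcal T_H)}^2.$$
   Context: Setting. Let $d\in\{2,3\}$, let $\Omega\subset\mathbb R^d$ be an open bounded domain with polyhedral boundary, and let $\mathcal A\in[L^\infty(\Omega)]^{d\times d}$ be a symmetric tensor such that for almost all $x\in\Omega$, $a_{\min}|w|^2\le a_-(x)|w|^2\le\mathcal A(x)w\cdot w\le a_+(x)|w|^2\le a_{\max}|w|^2$ for all $w\in\mathbb R^d$, where $a_{\min},a_{\max}$ are positive constants and $a_-(x),a_+(x)$ are the smallest and largest eigenvalues of $\mathcal A(x)$. $\mathcal T_H$ is a (shape) regular polyhedral mesh of $\Omega$ whose elements have diameter smaller than $H$; $N^f$ is the maximum number of faces of an element (''face'' means edge if $d=2$); $\mathcal F_H$ is its set of faces. $\mathcal F_h$ is a partition of these faces, of characteristic mesh size $h$, such that every face in $\mathcal F_H$ is a union of faces of $\mathcal F_h$. $n^\tau$ is the outward unit normal on $\partial\tau$. Spaces. $H^1(\mathcal T_H)=\{v\in L^2(\Omega): v|_\tau\in H^1(\tau),\ \tau\in\mathcal T_H\}$; $\Lambda(\mathcal T_H)=\{\prod_{\tau\in\mathcal T_H}\boldsymbol\tau\cdot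 n^\tau|_{\partial\tau}:\boldsymbol\tau\in H(\mathrm{div};\Omega)\}$ (so on an interior face an element takes opposite values on the two sides). $(\mu,v)_{\partial\tau}$ is the $H^{-1/2}(\partial\tau)$–$H^{1/2}(\partial\tau)$ duality (with the trace of $v$), and $(\mu,v)_{\partial\mathcal T_H}=\sum_{\tau\in\mathcal T_H}(\mu,v)_{\partial\tau}$. $\Lambda_h$ is the set of elements of $\Lambda(\mathcal T_H)$ that are constant on each face of $\mathcal F_h$. $\mathbb P^0(\mathcal T_H)$ is the space of functions constant on each $\tau\in\mathcal T_H$; $\widetilde H^1(\mathcal T_H)$ is the set of $v\in H^1(\mathcal T_H)$ with $\int_\tau v=0$ for all $\tau$. $\widetilde\Lambda_h=\{\mu_h\in\Lambda_h:(\mu_h,v^0)_{\partial\mathcal T_H}=0\ \forall v^0\in\mathbb P^0(\mathcal T_H)\}$, and $\widetilde\Lambda_h^f=\{\mu_h\in\widetilde\Lambda_h:\int_F\mu_h\,ds=0$ for each $F\in\mathcal F_H\}$. For $S\subset\mathcal T_H$, $|v|^2_{H^1_{\mathcal A}(S)}=\sum_{\tau\in S}\|\mathcal A^{1/2}\nabla v\|^2_{L^2(\tau)}$ (and one writes $\tau$ for $\{\tau\}$). Operators. $T:\Lambda(\mathcal T_H)\to\widetilde H^1(\mathcal T_H)$ is defined elementwise by $\int_\tau\mathcal A\nabla(T\mu)\cdot\nabla\tilde v\,dx=(\mu,\tilde v)_{\partial\tau}$ for all $\tilde v\in\widetilde H^1(\mathcal T_H)$, $\tau\in\mathcal T_H$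 (on a single element $T$ acts likewise on data given on $\partial\tau$). $P:H^1(\mathcal T_H)\to\widetilde\Lambda_h^f$ is defined by $(\tilde\mu_h^f,TPw)_{\partial\mathcal T_H}=(\tilde\mu_h^f,w)_{\partial\mathcal T_H}$ for all $\tilde\mu_h^f\in\widetilde\Lambda_h^f$. Constant $\alpha$. $\alpha=\gamma\kappa\beta_{H/h}^2$, where $\beta_{H/h}=1+\log(H/h)$, $\kappa=\max_{\tau\in\mathcal T_H}a_{\max}^\tau/a_{\min}^\tau$, $a_{\max}^\tau=\sup_{x\in\tau}a_+(x)$, $a_{\min}^\tau=\inf_{x\in\tau}a_-(x)$, and $\gamma>0$ is a constant depending only on the shape regularity of $\mathcal T_H$, such that for every $\tau\in\mathcal T_H$, every face $F$ of $\tau$ and every restriction $\tilde\mu_h^\tau$ to $\partial\tau$ of an element of $\widetilde\Lambda_h^f$, one has $|T(\chi_F\tilde\mu_h^\tau)|^2_{H^1_{\mathcal A}(\tau)}\le\alpha|T\tilde\mu_h^\tau|^2_{H^1_{\mathcal A}(\tau)}$ ($\chi_F$ the characteristic function of $F$). Patches. For $K\in\mathcal T_H$, $\mathcal T_0(K)=\emptyset$, $\mathcal T_1(K)=\{K\}$, and $\mathcal T_{j+1}(K)=\{\tau\in\mathcal T_H:\overline\tau\cap\overline{\tau_j}\ne\emptyset\text{ for some }\tau_j\in\mathcal T_j(K)\}$ for $j\ge1$. *)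

(* Defs.v *)
From HB Require Import structures.
From mathcomp Require Import all_boot all_order all_algebra.
From mathcomp Require Import all_classical all_reals all_analysis.

Set Implicit Arguments.
Unset Strict Implicit.
Unset Printing Implicit Defensive.
Import Order.TTheory GRing.Theory Num.Theory.
Import numFieldNormedType.Exports.

Local Open Scope classical_set_scope.
Local Open Scope ring_scope.

Definition measure_rV_display : measure_display -> measure_display.
Proof. exact. Qed.

Section measurable_rV.
Context {d} {T : sigmaRingType d}.
Variable n : nat.

Let coors : 'I_n -> 'rV[T]_n -> T := fun i x => x ord0 i.

Let rV_set0 : g_sigma_preimage coors set0.
Proof. exact: sigma_algebra0. Qed.

Let rV_setC A : g_sigma_preimage coors A -> g_sigma_preimage coors (~` A).
Proof. exact: sigma_algebraC. Qed.

Let rV_bigcup (F : _^nat) : (forall i, g_sigma_preimage coors (F i)) ->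
  g_sigma_preimage coors (\bigcup_i (F i)).
Proof. exact: sigma_algebra_bigcup. Qed.

HB.instance Definition _ := @isMeasurable.Build (measure_rV_display d)
  'rV[T]_n (g_sigma_preimage coors) rV_set0 rV_setC rV_bigcup.

End measurable_rV.


Section measurable_fun_rV.
Context d1 d2 (T1 : measurableType d1) (T2 : measurableType d2).

Lemma measurable_coord n (i : 'I_n) :
  measurable_fun [set: 'rV[T2]_n] (fun x => x ord0 i).
Proof.
move=> _ Y mY; rewrite setTI; apply: sub_sigma_algebra => /=.
rewrite -bigcup_seq/=; exists i => /=; first by rewrite mem_index_enum.
by exists Y => //; rewrite setTI.
Qed.

Lemma measurable_fun_rV n (f : T1 -> 'rV[T2]_n) :
  (forall i, measurable_fun [set: T1] (fun x => f x ord0 i)) ->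
  measurable_fun [set: T1] f.
Proof.
move=> mf _ Y mY; rewrite setTI.
move: Y mY; apply: smallest_sub.
  split=> /=.
  - by rewrite preimage_set0.
  - by move=> A mA; rewrite setTD preimage_setC; exact: measurableC.
  - by move=> F mF; rewrite preimage_bigcup; exact: bigcup_measurable.
rewrite -bigcup_seq => A [i /= _ [B mB <-]].
by rewrite setTI; have := mf i measurableT _ mB; rewrite setTI.
Qed.

End measurable_fun_rV.

Section lebesgue_rV.
Variable R : realType.

Definition rV_cons n (p : measurableTypeR R * 'rV[R]_n) : 'rV[R]_n.+1 :=
  \row_i oapp (fun j => p.2 ord0 j) p.1 (unlift ord0 i).

Definition rV_uncons n (x : 'rV[R]_n.+1) : measurableTypeR R * 'rV[R]_n :=
  (x ord0 ord0, \row_j x ord0 (lift ord0 j)).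

Lemma rV_consK n : cancel (@rV_cons n) (@rV_uncons n).
Proof.
move=> [a x]; rewrite /rV_uncons/= mxE unlift_none/=; congr (_, _).
by apply/rowP => j; rewrite !mxE liftK.
Qed.

Lemma measurable_rV_cons n : measurable_fun setT (@rV_cons n).
Proof.
apply: measurable_fun_rV => i.
case: (unliftP ord0 i) => [j|] ->.
- under eq_fun do rewrite mxE liftK/=.
  by apply: (measurableT_comp (measurable_coord j)).
- under eq_fun do rewrite mxE unlift_none/=.
  exact: measurable_fst.
Qed.

Lemma measurable_rV_uncons n : measurable_fun setT (@rV_uncons n).
Proof.
apply/measurable_fun_pairP; split; first exact: measurable_coord.
apply: measurable_fun_rV => j /=.
by under eq_fun do rewrite mxE; exact: measurable_coord.
Qed.

Section step.
Variables (n : nat) (m : {sigma_finite_measure set 'rV[R]_n -> \bar R}).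

Let prod : {measure set (measurableTypeR R * 'rV[R]_n)%type -> \bar R} :=
  (lebesgue_measure \x m)%E.

Definition lebesgue_rV_cons : set 'rV[R]_n.+1 -> \bar R :=
  pushforward prod (@rV_cons n).

HB.instance Definition _ := Measure.copy lebesgue_rV_cons
  (measure_function_pushforward__canonical__measure_function_Measure
     prod (@measurable_rV_cons n)).

Let sigma_finite_lebesgue_rV_cons : sigma_finite setT lebesgue_rV_cons.
Proof.
have /sigma_finiteP[F [TF ndF mF]] := sigma_finiteT (@lebesgue_measure R).
have /sigma_finiteP[G [TG ndG mG]] := sigma_finiteT m.
exists (fun k => @rV_uncons n @^-1` (F k `*` G k)).
  apply/seteqP; split=> // x _.
  have [i _ Fi] : (\bigcup_i F i) (rV_uncons x).1 by rewrite -TF.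
  have [j _ Gj] : (\bigcup_i G i) (rV_uncons x).2 by rewrite -TG.
  exists (maxn i j) => //; split.
    by move: Fi; exact/subsetPset/ndF/leq_maxl.
  by move: Gj; exact/subsetPset/ndG/leq_maxr.
move=> k; have [mFk Fkoo] := mF k; have [mGk Gkoo] := mG k; split.
  rewrite -[X in measurable X]setTI; apply: measurable_rV_uncons => //.
  exact: measurableX.
rewrite /lebesgue_rV_cons /pushforward.
rewrite (_ : _ @^-1` _ = F k `*` G k); last first.
  by apply/funext => p; rewrite /preimage /mkset rV_consK.
by rewrite /prod/= product_measure1E// lte_mul_pinfty// ge0_fin_numE.
Qed.

HB.instance Definition _ := Measure_isSigmaFinite.Build _ _ _ lebesgue_rV_cons
  sigma_finite_lebesgue_rV_cons.

End step.

Fixpoint lebesgue_rV n : {sigma_finite_measure set 'rV[R]_n -> \bar R} :=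
  match n with
  | 0 => dirac (0 : 'rV[R]_0)
  | k.+1 => lebesgue_rV_cons (lebesgue_rV k)
  end.

End lebesgue_rV.

Section euclidean.
Variables (R : realType) (n : nat).
Implicit Types (x y : 'rV[R]_n) (U : set 'rV[R]_n).

Definition dotv x y : R := \sum_(i < n) x ord0 i * y ord0 i.

(* The library norm on matrices is the sup norm. *)
Definition enorm x : R := Num.sqrt (dotv x x).

Definition eball x (r : R) : set 'rV[R]_n := [set y | enorm (y - x) < r].

Definition diam U : R :=
  sup [set r | exists2 x, U x & exists2 y, U y & r = enorm (x - y)].

Definition bnd U : set 'rV[R]_n := closure U `\` interior U.

Definition polytope U :=
  exists m (p : 'I_m -> 'rV[R]_n), U = [set x | exists t : 'I_m -> R,
    [/\ forall i, 0 <= t i, \sum_(i < m) t i = 1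
      & x = \sum_(i < m) t i *: p i]].

(* A polyhedral domain is thus open, bounded, connected, and lies locally on
   one side of its faces (no cracks); it need be neither convex nor simply
   connected. *)
Definition polyhedral_domain U :=
  [/\ U !=set0, connected U & exists m (D : 'I_m -> set 'rV[R]_n),
    (forall i, polytope (D i)) /\ U = interior (\bigcup_i D i)].

End euclidean.

Section sobolev.
Variables (R : realType) (n : nat).
Local Notation E := ('rV[R]_n).
Local Notation leb := (lebesgue_rV R n).
Implicit Types (U : set E) (f phi : E -> R).

Definition partial (i : 'I_n) f : E -> R := fun x => 'D_(delta_mx ord0 i) f x.

Definition grad f : E -> E := fun x => \row_i partial i f x.

Fixpoint Ck (k : nat) f : Prop :=
  continuous f /\
  match k with
  | 0 => True
  | k'.+1 => forall i : 'I_n,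
      (forall x, derivable f x (delta_mx ord0 i)) /\ Ck k' (partial i f)
  end.

Definition smooth f := forall k, Ck k f.

Definition test_fun U phi :=
  [/\ smooth phi, compact (closure [set x | phi x != 0])
    & closure [set x | phi x != 0] `<=` U].

Definition L2 U : set (E -> R) :=
  [set f : E -> R | measurable_fun U f /\ leb.-integrable U (fun x => (f x ^+ 2)%:E)].

Definition L2v U : set (E -> E) :=
  [set g : E -> E | forall i, L2 U (fun x => g x ord0 i)].

(* An element of H^1(U) is represented by a function v.1 together with a
   representative v.2 of its weak gradient, and an element of H(div; U) by a
   field s.1 together with a representative s.2 of its weak divergence.  As
   weak derivatives are unique up to null sets, these are the usual spaces.
   Nothing is required outside U. *)
Definition sob : Type := (E -> R) * (E -> E).

Definition H1 U : set sob :=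
  [set v | [/\ L2 U v.1, L2v U v.2 & forall phi, test_fun U phi -> forall i,
    \int[leb]_(x in U) (v.1 x * partial i phi x) =
    - \int[leb]_(x in U) (v.2 x ord0 i * phi x)]].

Definition Hdiv U : set ((E -> E) * (E -> R)) :=
  [set s | [/\ L2v U s.1, L2 U s.2 & forall phi, test_fun U phi ->
    \int[leb]_(x in U) dotv (s.1 x) (grad phi x) =
    - \int[leb]_(x in U) (s.2 x * phi x)]].

Definition H1norm U (v : sob) : R :=
  Num.sqrt (\int[leb]_(x in U) (v.1 x ^+ 2 + dotv (v.2 x) (v.2 x))).

Definition add_scale (a : R) (v w : sob) : sob :=
  (fun x => a * v.1 x + w.1 x, fun x => a *: v.2 x + w.2 x).

End sobolev.

Section mesh.
Variables (R : realType) (d : nat).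
Local Notation E := ('rV[R]_d).
Local Notation leb := (lebesgue_rV R d).

(* A flat (d-1)-dimensional piece of R^d: the image of pdom under the affine
   map y |-> porig + y *m pframe, an isometry when the rows of pframe are
   orthonormal.  Surface integrals are Lebesgue integrals over pdom. *)
Record piece := Piece {
  porig : E;
  pframe : 'M[R]_(d.-1, d);
  pdom : set 'rV[R]_d.-1 }.

Definition pparam (F : piece) (y : 'rV[R]_d.-1) : E := porig F + y *m pframe F.

Definition carrier (F : piece) : set E := pparam F @` pdom F.

Definition is_piece (F : piece) :=
  pframe F *m (pframe F)^T = 1%:M /\ polyhedral_domain (pdom F).

Definition surf_int (F : piece) (f : E -> R) : R :=
  \int[lebesgue_rV R d.-1]_(y in pdom F) f (pparam F y).

Definition surf_ae (F : piece) (Q : E -> Prop) : Prop :=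
  {ae lebesgue_rV R d.-1, forall y, pdom F y -> Q (pparam F y)}.

(* The elements of T_H, the faces in F_H and those in F_h; faces are
   relatively open, as elements are open. *)
Record mesh := Mesh {
  cell : finType;
  elt : cell -> set E;
  face : finType;
  face_piece : face -> piece;
  subface : finType;
  subface_piece : subface -> piece }.

Section predicates.
Variable M : mesh.
Local Notation cell := (cell M).
Local Notation face := (face M).
Local Notation subface := (subface M).
Implicit Types (K tau : cell) (F : face) (e : subface).

Definition face_of F tau : bool :=
  `[< carrier (face_piece F) `<=` bnd (elt tau) >].

Definition subface_in e F : bool :=
  `[< carrier (subface_piece e) `<=` carrier (face_piece F) >].

Definition subface_of e tau : bool := [exists F, subface_in e F && face_of F tau].

Definition is_mesh (Omega : set E) (H : R) :=
  [/\ [/\ forall tau, polyhedral_domain (elt tau),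
      forall tau, diam (elt tau) < H,
      forall tau tau', tau != tau' -> elt tau `&` elt tau' = set0,
      forall tau, elt tau `<=` Omega
    & closure Omega = \bigcup_(tau : cell) closure (elt tau)],
   [/\ forall F, is_piece (face_piece F),
      forall F F', F != F' ->
        carrier (face_piece F) `&` carrier (face_piece F') = set0
    & forall tau, bnd (elt tau) =
        \bigcup_(F in [set F | face_of F tau]) closure (carrier (face_piece F))]
  & forall F,
      (carrier (face_piece F) `<=` bnd Omega /\
         #|[pred tau : cell | face_of F tau]| = 1%N) \/
      (carrier (face_piece F) `<=` Omega /\
         #|[pred tau : cell | face_of F tau]| = 2%N)].

Definition is_submesh (h : R) :=
  [/\ forall e, is_piece (subface_piece e),
      forall e e', e != e' ->
        carrier (subface_piece e) `&` carrier (subface_piece e') = set0,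
      forall e, exists F, subface_in e F,
      forall F, closure (carrier (face_piece F)) =
        \bigcup_(e in [set e | subface_in e F]) closure (carrier (subface_piece e))
    & forall e, diam (carrier (subface_piece e)) <= h].

Definition shape_regular (rho : R) :=
  forall tau,
    (exists x, eball x (rho * diam (elt tau)) `<=` elt tau) /\
    (forall F, face_of F tau ->
      exists y, eball y (rho * diam (elt tau)) `<=` pdom (face_piece F)).

Definition max_faces : nat := (\max_(tau : cell) #|[pred F : face | face_of F tau]|)%N.

Fixpoint cell_patch (j : nat) (K : cell) : {set cell} :=
  match j with
  | 0 => finset.set0
  | j'.+1 => match j' with
    | 0 => finset.set1 K
    | _ => [set tau | [exists tau' in cell_patch j' K,
             `[< closure (elt tau) `&` closure (elt tau') !=set0 >]]]%SET
    end
  end.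

(* The trace operators H^1(tau) -> L^2(boundary of tau), pinned down by the
   density in H^1(tau) of the smooth functions. *)
Definition is_trace (tr : cell -> (E -> R) -> (E -> R)) :=
  forall tau,
  [/\ forall phi, smooth phi -> forall e, subface_of e tau ->
        surf_ae (subface_piece e) (fun x => tr tau phi x = phi x),
      forall a v w, H1 (elt tau) v -> H1 (elt tau) w ->
        forall e, subface_of e tau -> surf_ae (subface_piece e) (fun x =>
          tr tau (add_scale a v w).1 x = a * tr tau v.1 x + tr tau w.1 x),
      forall v, H1 (elt tau) v -> forall e, subface_of e tau ->
        L2 (pdom (subface_piece e)) (tr tau v.1 \o pparam (subface_piece e))
    & exists C : R, forall v, H1 (elt tau) v ->
        \sum_(e | subface_of e tau)
          surf_int (subface_piece e) (fun x => tr tau v.1 x ^+ 2)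
        <= C * H1norm (elt tau) v ^+ 2].

(* Families, indexed by the elements, of functionals v |-> (mu, v)_{d tau}. *)
Definition bdata : Type := cell -> (E -> R) -> R.

Section spaces.
Variables (Omega : set E) (tr : cell -> (E -> R) -> (E -> R)).

(* H^{-1/2}(d tau), the dual of the trace space H^{1/2}(d tau) of H^1(tau)
   with its quotient norm. *)
Definition Hmhalf tau : set ((E -> R) -> R) :=
  [set l | [/\ forall a v w, H1 (elt tau) v -> H1 (elt tau) w ->
        l (add_scale a v w).1 = a * l v.1 + l w.1,
      exists C : R, forall v, H1 (elt tau) v ->
        `|l v.1| <= C * H1norm (elt tau) v
    & forall v, H1 (elt tau) v ->
        (forall e, subface_of e tau ->
           surf_ae (subface_piece e) (fun x => tr tau v.1 x = 0)) ->
        l v.1 = 0]].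

(* For v in the broken space, v.2 is the elementwise gradient. *)
Definition broken_H1 : set (sob R d) :=
  [set v | L2 Omega v.1 /\ forall tau, H1 (elt tau) v].

Definition broken_H1_0 : set (sob R d) :=
  [set v | broken_H1 v /\ forall tau, \int[leb]_(x in elt tau) v.1 x = 0].

Definition P0 : set (E -> R) :=
  [set v | forall tau, exists a, forall x, elt tau x -> v x = a].

Definition pairing (mu : bdata) (v : E -> R) : R := \sum_tau mu tau v.

(* (s.n, v)_{d tau} is given by Green's formula. *)
Definition Lambda : set bdata :=
  [set mu | exists2 s, Hdiv Omega s & forall tau v, H1 (elt tau) v ->
    mu tau v.1 =
    \int[leb]_(x in elt tau) (dotv (s.1 x) (v.2 x) + s.2 x * v.1 x)].

(* Piecewise constant data: c tau e is the value on e, seen from tau. *)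
Definition coefs : Type := cell -> subface -> R.

Definition pw_const (c : coefs) : bdata := fun tau v =>
  \sum_(e | subface_of e tau) c tau e * surf_int (subface_piece e) (tr tau v).

(* The sign rule on interior faces is a consequence of membership in Lambda:
   normal components of H(div) fields match across elements. *)
Definition Lambda_h : set coefs :=
  [set c | Lambda (pw_const c) /\
    forall tau tau' e, tau != tau' -> subface_of e tau -> subface_of e tau' ->
      c tau e = - c tau' e].

Definition tLambda_h : set coefs :=
  [set c | Lambda_h c /\ forall v0, P0 v0 -> pairing (pw_const c) v0 = 0].

Definition tLambda_h_f : set coefs :=
  [set c | tLambda_h c /\ forall tau F, face_of F tau ->
    \sum_(e | subface_in e F) surf_int (subface_piece e) (cst (c tau e)) = 0].

(* chi_F times the restriction of c to the boundary of tau, extended by zero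
   to the boundaries of the other elements. *)
Definition chi tau F (c : coefs) : coefs := fun tau' e =>
  if (tau' == tau) && subface_in e F then c tau e else 0.

Variable A : E -> 'M[R]_d.

Definition flux (x w : E) : E := w *m (A x)^T.

(* The square norm of A^{1/2} grad v in L^2(tau), as A is symmetric. *)
Definition energy tau (v : sob R d) : R :=
  \int[leb]_(x in elt tau) dotv (flux x (v.2 x)) (v.2 x).

Definition H1A2 (S : {set cell}) (v : sob R d) : R :=
  \sum_(tau in S) energy tau v.

(* As it acts elementwise, T is taken on the product of all the H^{-1/2}(d tau),
   which contains Lambda(T_H) as well as the data supported on a single
   boundary. *)
Definition is_T (T : bdata -> sob R d) :=
  forall mu, (forall tau, Hmhalf tau (mu tau)) ->
    broken_H1_0 (T mu) /\
    forall v, broken_H1_0 v -> forall tau,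
      \int[leb]_(x in elt tau) dotv (flux x ((T mu).2 x)) (v.2 x) = mu tau v.1.

(* "c = P v" *)
Definition is_P (T : bdata -> sob R d) (v : sob R d) (c : coefs) :=
  tLambda_h_f c /\
  forall c', tLambda_h_f c' ->
    pairing (pw_const c') (T (pw_const c)).1 = pairing (pw_const c') v.1.

End spaces.

Section coefficient.
Variables (Omega : set E) (A : E -> 'M[R]_d).

Definition eig_min (x : E) : R := inf [set l | eigenvalue (A x) l].
Definition eig_max (x : E) : R := sup [set l | eigenvalue (A x) l].

Definition is_coefficient (amin amax : R) :=
  [/\ 0 < amin, 0 < amax,
      forall i j, measurable_fun Omega (fun x => A x i j)
    & {ae leb, forall x, Omega x -> (A x)^T = A x /\ forall w,
        [/\ amin * dotv w w <= eig_min x * dotv w w,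
            eig_min x * dotv w w <= dotv (flux A x w) w,
            dotv (flux A x w) w <= eig_max x * dotv w w
          & eig_max x * dotv w w <= amax * dotv w w]}].

(* A is only defined up to null sets: essential supremum and infimum. *)
Definition elt_max tau : R :=
  inf [set y | {ae leb, forall x, elt tau x -> eig_max x <= y}].
Definition elt_min tau : R :=
  sup [set y | {ae leb, forall x, elt tau x -> y <= eig_min x}].

Definition kappa : R := \big[Num.max/0]_tau (elt_max tau / elt_min tau).

Definition alpha (gamma H h : R) : R :=
  gamma * kappa * (1 + ln (H / h)) ^+ 2.

End coefficient.

End predicates.
End mesh.

(* Main.v *)
(* Let u = T mu, and let nu be the part of mu carried by the faces that touch no
   element of the j-th patch.  It still belongs to the discrete space, because
   A grad (T nu), taken elementwise, is a divergence-free H(div) field: the two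
   sides of an interior face cancel against a test function.  Since v vanishes
   off K, testing the equation for P v with nu gives sum_tau (nu, u)_tau = 0.
   Outside the (j+1)-st patch the summands are the energies of u, inside the
   j-th patch they vanish, and on the layer in between they are at least
   - N alpha times the energy.  With E_j the energy outside the j-th patch,
   this reads E_{j+1} <= N alpha (E_j - E_{j+1}), which is iterated.

   The bound on the layer uses alpha >= 1.  The hypothesis on alpha, applied to
   the part of mu carried by a single face, yields this unless all energies
   vanish. *)
Require Import Defs.
From mathcomp Require Import all_boot all_order all_algebra.
From mathcomp Require Import all_classical all_reals all_analysis.
From mathcomp Require Import measurable_realfun ring lra.

Set Implicit Arguments.
Unset Strict Implicit.
Unset Printing Implicit Defensive.
Import Order.TTheory GRing.Theory Num.Theory.
Import numFieldNormedType.Exports.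

Local Open Scope classical_set_scope.
Local Open Scope ring_scope.

(** * Lebesgue measure on row vectors *)

(** No Gauss theorem on polyhedra enters: the equation of [T] is itself Green's formula for the
    field A grad (T nu) with zero divergence, and the only integration by parts has a factor of
    compact support. It places smooth functions in H^1 of an element, which matters because traces
    are given explicitly on smooth functions only and reach the rest of H^1 through linearity and a
    bound. [T] is given by its equation alone and its values are representatives of classes modulo
    null sets. Comparisons are therefore made between pairings and mixed energies, never between the
    lifts themselves, and pairings must first be shown to ignore null sets. That alpha >= 1 cannot
    be read off its formula: gamma is merely positive, and 1 + ln (H / h) vanishes when h = e H. *)

Section measurable_rV_topology.
Variables (R : realType) (n : nat).
Implicit Types (U : set 'rV[R]_n) (f : 'rV[R]_n -> R).

Lemma ball_measurable_rV (x : 'rV[R]_n) (e : R) : measurable (ball x e).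
Proof.
have [e0|e0] := ltP 0 e; last first.
  by rewrite (_ : ball x e = set0)// -subset0 => y [/lt_le_trans/(_ e0)]; rewrite ltxx.
have -> : ball x e =
    \bigcap_(i in [set: 'I_n]) ((fun y : 'rV[R]_n => y ord0 i) @^-1` ball (x ord0 i) e).
  apply/seteqP; split=> [y [_ xy] i _|y xy]; first exact: xy.
  by split=> // i j; rewrite ord1; exact: xy.
apply: fin_bigcap_measurable => //= i _.
rewrite -[X in measurable X]setTI; apply: measurable_coord => //.
exact: measurable_ball.
Qed.

(** The sigma-algebra is generated by the coordinates and the topology by the sup norm. They are
    linked by writing [U] as a countable union of balls with rational centres and radii 1/(k+1); a
    radius below e/2 keeps such a ball, if it contains [x], inside the e-ball of [x]. *)
Lemma open_measurable_rV U : open U -> measurable U.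
Proof.
move=> oU.
pose B (p : 'rV[rat]_n * nat) : set 'rV[R]_n :=
  ball (map_mx (@ratr R) p.1 : 'rV[R]_n) (p.2.+1%:R^-1).
have -> : U = \bigcup_p (if asbool (B p `<=` U) then B p else set0).
  apply/seteqP; split=> [x Ux|x [p _]]; last by case: asboolP => // pU /pU.
  have [e /= e0 xeU] : nbhs_ball x U by rewrite nbhs_ballE; exact: open_nbhs_nbhs.
  have [k ke] : exists k : nat, k.+1%:R^-1 < e / 2.
    have e20 : 0 < e / 2 by exact: divr_gt0.
    have /cvgrPdist_lt/(_ _ e20)[k _ /(_ _ (leqnn k))] := @cvg_harmonic R.
    by rewrite sub0r normrN ger0_norm ?harmonic_ge0//; exists k.
  have [q xq] : exists q : 'rV[rat]_n, ball x k.+1%:R^-1 (map_mx (@ratr R) q).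
    have /choice[q xq] : forall i, exists q : rat, ball (x ord0 i) k.+1%:R^-1 (ratr q).
      move=> i; have [|q] := @rat_in_itvoo R (x ord0 i - k.+1%:R^-1) (x ord0 i + k.+1%:R^-1).
        by rewrite ltrBlDr -addrA ltrDl addr_gt0.
      by rewrite in_itv/= => xq; exists q; rewrite -ball_normE/= ltr_distlC.
    by exists (\row_i q i); split=> // i j; rewrite !mxE ord1; exact: xq.
  exists (q, k) => //=; case: asboolP => [_|]; first exact: ball_sym.
  case=> y By; apply: xeU.
  rewrite [e](_ : _ = e / 2 + e / 2); last by lra.
  by apply: ball_triangle; [apply: le_ball xq; exact: ltW|apply: le_ball By; exact: ltW].
apply: countable_bigcupT_measurable; first exact: countableP.
by move=> p; case: ifP => _ //; exact: ball_measurable_rV.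
Qed.

Lemma continuous_measurable_fun_rV f : continuous f -> measurable_fun setT f.
Proof.
move=> /continuousP cf; apply: (measurability _ (RGenOpens.measurableE R)).
move=> _ [_ [a [b ->] <-]]; rewrite setTI; apply: open_measurable_rV.
exact/cf/interval_open.
Qed.

End measurable_rV_topology.

Section lebesgue_rV_fubini.
Local Open Scope ereal_scope.
Variables (R : realType) (n : nat).
Implicit Types f : 'rV[R]_n.+1 -> \bar R.

(** [lebesgue_rV] is by construction the pushforward of a product measure under [rV_cons], so
    Fubini's theorem transfers along this map. *)
Lemma integrable_rV_cons f : (lebesgue_rV R n.+1).-integrable setT f ->
  ((lebesgue_measure \x lebesgue_rV R n)%E).-integrable setT (f \o @rV_cons R n).
Proof.
move=> /integrableP[mf foo]; apply/integrableP; split.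
  by apply: measurableT_comp => //; exact: measurable_rV_cons.
move: foo; rewrite (@ge0_integral_pushforward _ _ _ _ _ _ (@measurable_rV_cons R n))//.
exact: measurableT_comp.
Qed.

Lemma integral_rV_cons1 f : (lebesgue_rV R n.+1).-integrable setT f ->
  \int[lebesgue_rV R n.+1]_x f x =
  \int[lebesgue_measure]_t \int[lebesgue_rV R n]_y f (rV_cons (t, y)).
Proof.
move=> fi; have mf := measurable_int _ fi.
have fci := integrable_rV_cons fi.
rewrite (@integral12_prod_meas1 _ _ _ _ _ _ _ (f \o @rV_cons R n))//.
exact: (integral_pushforward (@measurable_rV_cons R n)).
Qed.

Lemma integral_rV_cons2 f : (lebesgue_rV R n.+1).-integrable setT f ->
  \int[lebesgue_rV R n.+1]_x f x =
  \int[lebesgue_rV R n]_y \int[lebesgue_measure]_t f (rV_cons (t, y)).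
Proof.
move=> fi; rewrite integral_rV_cons1//.
exact: (@Fubini _ _ _ _ _ _ _ (f \o @rV_cons R n) (integrable_rV_cons fi)).
Qed.

End lebesgue_rV_fubini.

Section lebesgue_rV_box.
Variable R : realType.

Definition box n (B : R) : set 'rV[R]_n := [set x | forall i, `|x ord0 i| <= B].

Lemma measurable_box n B : measurable (@box n B).
Proof.
have -> : box B =
    \bigcap_(i in [set: 'I_n]) ((fun y : 'rV[R]_n => y ord0 i) @^-1` `[- B, B]).
  apply/seteqP; split=> [y xy i _ /=|y xy i].
    by rewrite in_itv/= -ler_norml.
  by have := xy i Logic.I; rewrite /= in_itv/= -ler_norml.
apply: fin_bigcap_measurable => //= i _.
by rewrite -[X in measurable X]setTI; apply: measurable_coord.
Qed.

Lemma lebesgue_box n B : (lebesgue_rV R n (@box n B) < +oo)%E.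
Proof.
elim: n => [|n IH]; first by rewrite /= /dirac ltry.
rewrite /= /lebesgue_rV_cons /pushforward.
have -> : @rV_cons R n @^-1` box B = `[- B, B] `*` box B.
  apply/seteqP; split=> [[t y] /= ty|[t y] [/= tB yB] i].
    split => [|i].
      by have := ty ord0; rewrite mxE unlift_none/= in_itv/= -ler_norml.
    by have := ty (lift ord0 i); rewrite mxE liftK.
  case: (unliftP ord0 i) => [j|] ->; rewrite mxE ?liftK ?unlift_none//=.
  by move: tB; rewrite in_itv/= -ler_norml.
have mI : measurable (`[- B, B] : set (measurableTypeR R)) by exact: measurable_itv.
have lI : (lebesgue_measure `[(- B)%R, B]%classic < +oo)%E.
  by rewrite lebesgue_measure_itv/=; case: ifP; rewrite ?ltry.
have := product_measure1E lebesgue_measure (lebesgue_rV R n) mI (@measurable_box n B).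
move/(congr1 (fun z => z < +oo)%E) => ->.
by rewrite lte_mul_pinfty// ge0_fin_numE.
Qed.

End lebesgue_rV_box.

(** * Integrals of derivatives of functions with bounded support *)

Section integral_derive.
Variable R : realType.

Lemma integral_derive1_eq0 (f g : R -> R) (B : R) : continuous g ->
  (forall t : R, is_derive t 1 f (g t)) ->
  (forall t, B < `|t| -> f t = 0) -> (forall t, B < `|t| -> g t = 0) ->
  (\int[lebesgue_measure]_t (g t)%:E)%E = 0%E.
Proof.
move=> cg fg f0 g0.
(* [b] exceeds both 0 and [B]: the interval is nondegenerate and [f] vanishes at its endpoints. *)
pose b := `|B| + 1.
have b0 : 0 < b by rewrite ltr_pwDr.
have Bb : B < b by rewrite (le_lt_trans (ler_norm B))// ltrDl.
have cf : continuous f.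
  by move=> t; apply/differentiable_continuous/derivable1_diffP.
have -> : (fun t => (g t)%:E) = (EFin \o g) \_ (`[- b, b]%classic).
  apply/funext => t; rewrite patchE; case: ifPn => //.
  rewrite notin_setE/= in_itv/= => /negP; rewrite -ler_norml -ltNge => bt.
  by rewrite g0// (lt_trans Bb).
rewrite -integral_mkcond (@continuous_FTC2 _ g f)//.
- by rewrite f0 ?gtr0_norm// f0 ?normrN ?gtr0_norm// subee.
- by rewrite -subr_gt0 opprK addr_gt0.
- exact: continuous_subspaceT.
- split=> [t _| |]; first by have [] := fg t.
  + exact/cvg_at_right_filter/cf.
  + exact/cvg_at_left_filter/cf.
- by move=> t _; rewrite derive1E; have [_] := fg t.
Qed.

(** Increments along a basis vector become increments of a slice. With the next lemma, this carries
    partial derivatives through Fubini's theorem. *)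
Lemma rV_consDZ n (h t : R) (y : 'rV[R]_n) :
  h *: delta_mx ord0 ord0 + rV_cons (t, y) = rV_cons (h + t, y).
Proof.
apply/rowP => i; rewrite !mxE eqxx/=.
by case: (unliftP ord0 i) => [j|] -> /=; rewrite ?mulr0 ?add0r ?mulr1.
Qed.

Lemma rV_consDZ_lift n (h t : R) (y : 'rV[R]_n) j :
  h *: delta_mx ord0 (lift ord0 j) + rV_cons (t, y) =
  rV_cons (t, h *: delta_mx ord0 j + y).
Proof.
apply/rowP => i; rewrite !mxE eqxx/=.
case: (unliftP ord0 i) => [k|] -> /=; last by rewrite mulr0 add0r.
by rewrite !mxE/= (inj_eq lift_inj).
Qed.

Lemma continuous_rV_cons_l n (y : 'rV[R]_n) :
  continuous (fun t : R => rV_cons (t, y) : 'rV[R]_n.+1).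
Proof.
move=> t; apply/cvgrPdist_lt => e e0; near=> s.
rewrite [X in `|X|](_ : _ = rV_cons (t - s, 0 : 'rV[R]_n)); last first.
  apply/rowP => i; rewrite !mxE; case: (unlift ord0 i) => [j|] //=.
  by rewrite mxE subrr.
rewrite [ltLHS]mx_normrE (bigmax_lt _ e0)// => -[i j] _ /=; rewrite mxE.
case: (unlift ord0 j) => [k|] /=; first by rewrite mxE normr0.
by near: s; exact: cvgr_dist_lt.
Unshelve. all: by end_near. Qed.

Lemma continuous_rV_cons_r n (t : R) :
  continuous (fun y : 'rV[R]_n => rV_cons (t, y) : 'rV[R]_n.+1).
Proof.
move=> y; apply: (proj2 (@cvgrPdist_lt _ _ _ _ (nbhs_filter y) _ _)) => e e0.
have : \forall z \near y, ball y e z by exact: nbhsx_ballx.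
apply: filterS => z; rewrite -ball_normE/= => yz.
rewrite [X in `|X|](_ : _ = rV_cons (0, y - z)); last first.
  by apply/rowP => i; rewrite !mxE; case: (unlift ord0 i) => [j|] /=; rewrite ?mxE ?subrr.
rewrite [ltLHS]mx_normrE (bigmax_lt _ e0)// => -[i j] _ /=; rewrite mxE.
case: (unlift ord0 j) => [k|] /=; last by rewrite normr0.
rewrite (le_lt_trans _ yz)// [leRHS]mx_normrE.
exact: (le_bigmax _ (fun ij : 'I_1 * 'I_n => `|(y - z) ij.1 ij.2|) (ord0, k)).
Qed.

Lemma bounded_integrable_box n (g : 'rV[R]_n -> R) (B C : R) :
  measurable_fun setT g -> (forall x, `|g x| <= C) ->
  (forall x, ~ box B x -> g x = 0) ->
  (lebesgue_rV R n).-integrable setT (EFin \o g).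
Proof.
move=> mg gC g0.
have -> : EFin \o g = (EFin \o g) \_ (box B).
  apply/funext => x; rewrite patchE; case: ifPn => //.
  by rewrite notin_setE/= => /g0 ->.
apply: (proj1 (integrable_mkcond _ (@measurable_box _ n B))).
apply: measurable_bounded_integrable.
- exact: measurable_box.
- exact: lebesgue_box.
- exact: measurable_funTS.
- by exists C; split; [exact: num_real|move=> M CM x _ /=; exact: le_trans (gC x) (ltW CM)].
Qed.

(** Induction on the dimension, with both orders of integration: if [i] is the first coordinate it
    is integrated innermost, by the one-dimensional case; otherwise the first coordinate is frozen
    and the induction hypothesis applies to the slice. *)
Lemma integral_derive_eq0 n (i : 'I_n) (f g : 'rV[R]_n -> R) (B C : R) :
  continuous g -> (forall x, `|g x| <= C) ->
  (forall x, is_derive x (delta_mx ord0 i) f (g x)) ->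
  (forall x, ~ box B x -> f x = 0) -> (forall x, ~ box B x -> g x = 0) ->
  (\int[lebesgue_rV R n]_x (g x)%:E)%E = 0%E.
Proof.
elim: n i f g => [[]//|n IH] i f g cg gC fg f0 g0.
have gi : (lebesgue_rV R n.+1).-integrable setT (EFin \o g).
  exact: (bounded_integrable_box (continuous_measurable_fun_rV cg) gC g0).
have consF (h : 'rV[R]_n.+1 -> R) t y : (forall x, ~ box B x -> h x = 0) ->
    B < `|t| \/ ~ box B y -> h (rV_cons (t, y)) = 0.
  move=> h0 ty; apply: h0 => by_; case: ty => [|]; last first.
    by apply => j; have := by_ (lift ord0 j); rewrite mxE liftK.
  by apply/negP; rewrite -leNgt; have := by_ ord0; rewrite mxE unlift_none.
case: (unliftP ord0 i) => [j|] ij.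
  rewrite (integral_rV_cons1 gi) integral0_eq// => t _ /=.
  apply: (IH j (fun y => f (rV_cons (t, y))) (fun y => g (rV_cons (t, y)))).
  - by move=> y; apply: continuous_comp; [exact: continuous_rV_cons_r|exact: cg].
  - by [].
  - move=> y; have := fg (rV_cons (t, y)); rewrite ij => -[df gE]; split.
    + move: df; rewrite /derivable/=.
      by under eq_fun do rewrite rV_consDZ_lift.
    + rewrite -gE /derive/=.
      by under [in RHS]eq_fun do rewrite rV_consDZ_lift.
  - by move=> y yB; apply: consF => //; right.
  - by move=> y yB; apply: consF => //; right.
rewrite (integral_rV_cons2 gi) integral0_eq// => y _ /=.
apply: (@integral_derive1_eq0 (fun t => f (rV_cons (t, y))) (fun t => g (rV_cons (t, y))) B).
- by move=> t; apply: continuous_comp; [exact: continuous_rV_cons_l|exact: cg].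
- move=> t; have := fg (rV_cons (t, y)); rewrite ij => -[df gE]; split.
  + move: df; rewrite /derivable/=.
    (* The increment [h] is written [h * 1], the form it has in a difference quotient on the line in
       direction 1. *)
    by under eq_fun do rewrite rV_consDZ -[X in rV_cons (X + _, _)]mulr1.
  + rewrite -gE /derive/=.
    by under [in RHS]eq_fun do rewrite rV_consDZ -[X in rV_cons (X + _, _)]mulr1.
- by move=> t tB; apply: consF => //; left.
- by move=> t tB; apply: consF => //; left.
Qed.

End integral_derive.

(** * Sobolev functions on polyhedral domains *)

Section square_integrable.
Variables (R : realType) (n : nat) (U : set 'rV[R]_n).
Hypothesis mU : measurable U.
Implicit Types f g : 'rV[R]_n -> R.
Local Notation leb := (lebesgue_rV R n).

Lemma L2M_integrable f g : L2 U f -> L2 U g ->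
  leb.-integrable U (EFin \o (fun x => f x * g x)).
Proof.
move=> [mf fi] [mg gi].
apply: (@le_integrable _ _ _ _ _ mU _ (fun x => (f x ^+ 2)%:E + (g x ^+ 2)%:E)%E).
- by apply/measurable_EFinP; exact: measurable_funM.
- move=> x _ /=; rewrite lee_fin [leRHS]ger0_norm ?addr_ge0 ?sqr_ge0//.
  rewrite normrM -(real_normK (num_real (f x))) -(real_normK (num_real (g x))).
  have := sqr_ge0 (`|f x| - `|g x|); have := normr_ge0 (f x); have := normr_ge0 (g x).
  by nra.
- exact: integrableD.
Qed.

Lemma L2D f g : L2 U f -> L2 U g -> L2 U (fun x => f x + g x).
Proof.
move=> Lf Lg; have [mf fi] := Lf; have [mg gi] := Lg; split.
  exact: measurable_funD.
apply: (eq_integrable mU (fun x => (f x ^+ 2)%:E + 2%:E * (f x * g x)%:E + (g x ^+ 2)%:E)%E).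
  by move=> x _; rewrite -EFinM -!EFinD; congr EFin; ring.
apply: integrableD => //; apply: integrableD => //; apply: integrableZl => //.
exact: L2M_integrable.
Qed.

Lemma L2Z a f : L2 U f -> L2 U (fun x => a * f x).
Proof.
move=> [mf fi]; split; first exact: measurable_funM.
apply: (eq_integrable mU (fun x => (a ^+ 2)%:E * (f x ^+ 2)%:E)%E).
  by move=> x _; rewrite -EFinM exprMn.
exact: integrableZl.
Qed.

Lemma L2_bounded f (C : R) : (leb U < +oo)%E -> measurable_fun U f ->
  (forall x, U x -> `|f x| <= C) -> L2 U f.
Proof.
move=> Uoo mf fC; split => //.
apply: measurable_bounded_integrable => //; first exact: measurable_funX.
exists (C ^+ 2); split; first exact: num_real.
move=> D CD x Ux /=; rewrite (le_trans _ (ltW CD))// normrX lerXn2r ?nnegrE//.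
  by rewrite (le_trans _ (fC x Ux)).
exact: fC.
Qed.

Lemma L2_cst (a : R) : (leb U < +oo)%E -> L2 U (cst a).
Proof. by move=> Uoo; apply: (@L2_bounded _ `|a|). Qed.

Lemma L2_integrable f : (leb U < +oo)%E -> L2 U f -> leb.-integrable U (EFin \o f).
Proof.
move=> Uoo fL; have := L2M_integrable fL (L2_cst 1 Uoo).
by apply: eq_integrable => // x _ /=; rewrite mulr1.
Qed.

Lemma L2_eq_on f g : (forall x, U x -> f x = g x) -> L2 U f -> L2 U g.
Proof.
move=> fg [mf fi]; split.
  by apply: eq_measurable_fun mf => x /[!inE]; exact: fg.
by apply: eq_integrable fi => // x /[!inE] Ux; rewrite fg.
Qed.

Lemma L2_sum (I : Type) (s : seq I) (f : I -> 'rV[R]_n -> R) :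
  (leb U < +oo)%E -> (forall i, L2 U (f i)) -> L2 U (fun x => \sum_(i <- s) f i x).
Proof.
move=> Uoo Lf; elim: s => [|i s IH].
  by refine (L2_eq_on _ (L2_cst 0 Uoo)) => x _; rewrite big_nil.
by refine (L2_eq_on _ (L2D (Lf i) IH)) => x _; rewrite big_cons.
Qed.

(** Meant for the entries of [A], which are bounded only almost everywhere; hence the integrals are
    compared, not the integrands pointwise. *)
Lemma L2M_bounded (h f : 'rV[R]_n -> R) (C : R) : measurable_fun U h ->
  {ae leb, forall x, U x -> `|h x| <= C} ->
  L2 U f -> L2 U (fun x => h x * f x).
Proof.
move=> mh hC [mf fi]; have mhf := measurable_funM mh mf; split => //.
have mhf2 := measurable_funX 2 mhf.
apply/integrableP; split; first exact/measurable_EFinP.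
apply: (@le_lt_trans _ _ (\int[leb]_(x in U) ((C ^+ 2)%:E * (f x ^+ 2)%:E))%E).
  apply: ae_ge0_le_integral => //.
  - by do 2 apply: measurableT_comp => //.
  - by move=> x _; rewrite -EFinM lee_fin mulr_ge0 ?sqr_ge0.
  - by apply/measurable_EFinP/measurable_funM => //; exact: measurable_funX.
  - apply: filterS hC => x hC Ux; rewrite /= -EFinM lee_fin ger0_norm ?sqr_ge0//.
    rewrite exprMn ler_wpM2r ?sqr_ge0// -(real_normK (num_real (h x))).
    by rewrite lerXn2r ?nnegrE ?hC// (le_trans _ (hC Ux)).
have /integrableP[_] := integrableZl mU (C ^+ 2) fi.
apply: le_lt_trans; apply: ge0_le_integral => //.
- by move=> x _; rewrite -EFinM lee_fin mulr_ge0 ?sqr_ge0.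
- by apply/measurable_EFinP/measurable_funM => //; exact: measurable_funX.
- apply: measurableT_comp => //.
  by apply/measurable_EFinP/measurable_funM => //; exact: measurable_funX.
- by move=> x _; exact: lee_abs.
Qed.

End square_integrable.

Section polyhedral_domains.
Variables (R : realType) (n : nat).
Implicit Types U : set 'rV[R]_n.
Local Notation leb := (lebesgue_rV R n).

Lemma coord_le_norm (x : 'rV[R]_n) i : `|x ord0 i| <= `|x|.
Proof.
rewrite [leRHS]mx_normrE.
exact: (le_bigmax _ (fun ij : 'I_1 * 'I_n => `|x ij.1 ij.2|) (ord0, i)).
Qed.

Lemma polytope_box U : polytope U -> exists B, U `<=` box B.
Proof.
move=> [m [p ->]]; exists (\sum_(i < m) `|p i|) => x [t [t0 t1 ->]] k.
rewrite (le_trans (coord_le_norm _ k))// (le_trans (ler_norm_sum _ _ _))//.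
apply: ler_sum => i _; rewrite normrZ ger0_norm// ler_piMl//.
by rewrite -t1 (bigD1 i)//= lerDl sumr_ge0.
Qed.

Lemma polyhedral_domain_box U : polyhedral_domain U -> exists B, U `<=` box B.
Proof.
move=> [_ _ [m [D [pD ->]]]].
have /choice[B DB] i := polytope_box (pD i).
exists (\sum_(i < m) `|B i|) => x /interior_subset[i _ /DB xB] k.
rewrite (le_trans (xB k))// (le_trans (ler_norm _))// (bigD1 i)//= lerDl.
exact: sumr_ge0.
Qed.

Lemma polyhedral_domain_open U : polyhedral_domain U -> open U.
Proof. by move=> [_ _ [m [D [_ ->]]]]; exact: open_interior. Qed.

Lemma polyhedral_domain_measurable U : polyhedral_domain U -> measurable U.
Proof. by move=> /polyhedral_domain_open/open_measurable_rV. Qed.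

Lemma polyhedral_domain_lty U : polyhedral_domain U -> (leb U < +oo)%E.
Proof.
move=> pU; have [B UB] := polyhedral_domain_box pU.
apply: le_lt_trans (lebesgue_box n B); apply: le_measure => //; rewrite inE.
  exact: polyhedral_domain_measurable.
exact: measurable_box.
Qed.

End polyhedral_domains.

(** * Smooth functions and test functions *)

Section test_functions.
Variables (R : realType) (n : nat).
Implicit Types (U : set 'rV[R]_n) (f phi psi : 'rV[R]_n -> R).
Local Notation leb := (lebesgue_rV R n).

Lemma compact_box (B : R) : compact (@box R n B).
Proof.
have cb : compact [set v : 'rV[R]_n | forall i, v ord0 i \in `[(- B), B]].
  apply: (@rV_compact _  _ (fun=> `[- B, B]%classic)).
  by move=> _; exact: segment_compact.
rewrite (_ : box B = [set v : 'rV[R]_n | forall i, v ord0 i \in `[(- B), B]])//.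
by apply/seteqP; split=> v vB i; have := vB i; rewrite /= in_itv/= ler_norml.
Qed.

Lemma continuous_bounded_compact f (K : set 'rV[R]_n) : continuous f -> compact K ->
  exists C, forall x, K x -> `|f x| <= C.
Proof.
move=> cf cK; have /compact_bounded[C [_ fC]] : compact (f @` K).
  by apply: continuous_compact => //; exact: continuous_subspaceT.
by exists (C + 1) => x Kx; apply: (fC (C + 1)); rewrite ?ltrDl//; exists x.
Qed.

Lemma smooth_continuous f : smooth f -> continuous f.
Proof. by move=> /(_ 0%N)[]. Qed.

Lemma smooth_continuous_partial f i : smooth f -> continuous (partial i f).
Proof. by move=> /(_ 1%N)[_ /(_ i)[_ []]]. Qed.

Lemma smooth_is_derive f i x : smooth f ->
  is_derive x (delta_mx ord0 i) f (partial i f x).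
Proof. by move=> /(_ 1%N)[_ /(_ i)[/(_ x) df _]]; split. Qed.

Lemma smooth_cst (a : R) : smooth (cst a : 'rV[R]_n -> R).
Proof.
move=> k; elim: k a => [|k IH] a; split => //; try exact: cst_continuous.
move=> i; split; first by move=> x; exact: derivable_cst.
rewrite (_ : partial i _ = cst 0); first exact: IH.
by apply/funext => x; rewrite /partial derive_cst.
Qed.

Lemma test_fun_eq0 U phi x : test_fun U phi -> ~ U x -> phi x = 0.
Proof.
move=> [_ _ sU] Ux; apply: contrapT => /eqP px; apply/Ux/sU.
exact: subset_closure.
Qed.

(** The complement of the closed support is open, so [phi] vanishes in a neighbourhood of [x]. *)
Lemma test_fun_partial_eq0 U phi x i : test_fun U phi -> ~ U x -> partial i phi x = 0.
Proof.
move=> [_ _ sU] Ux.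
transitivity ('D_(delta_mx ord0 i) (cst 0 : 'rV[R]_n -> R) x); last exact: derive_cst.
apply: near_eq_derive; have /open_nbhs_nbhs : open_nbhs x (~` closure [set x | phi x != 0]).
  by split; [exact/closed_openC/closed_closure|by move/sU].
by apply: filterS => y yS; apply: contrapT => /eqP py; apply/yS/subset_closure.
Qed.

Lemma smooth_L2 U f (B : R) : smooth f -> measurable U -> (leb U < +oo)%E ->
  U `<=` box B -> L2 U f /\ L2v U (grad f).
Proof.
move=> sf mU Uoo UB.
have L2c (h : 'rV[R]_n -> R) : continuous h -> L2 U h.
  move=> ch; have [C hC] := continuous_bounded_compact ch (@compact_box B).
  apply: (@L2_bounded _ _ _ _ _ C) => //; last by move=> x /UB/hC.
  exact: measurable_funTS (continuous_measurable_fun_rV ch).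
split; first exact/L2c/smooth_continuous.
move=> i; refine (L2_eq_on mU _ (L2c _ (@smooth_continuous_partial f i sf))) => x _.
by rewrite mxE.
Qed.

(* The boundary term of Gauss's theorem vanishes because [phi] has compact
   support in [U]. *)
Lemma integral_partial_by_parts U psi phi i : polyhedral_domain U ->
  smooth psi -> test_fun U phi ->
  \int[leb]_(x in U) (psi x * partial i phi x) =
  - \int[leb]_(x in U) (partial i psi x * phi x).
Proof.
move=> pU spsi tphi; have [sphi cphi _] := tphi.
have mU := polyhedral_domain_measurable pU; have Uoo := polyhedral_domain_lty pU.
have [B UB] := polyhedral_domain_box pU.
have [Lpsi Lgpsi] := smooth_L2 spsi mU Uoo UB.
have [Lphi Lgphi] := smooth_L2 sphi mU Uoo UB.
have Lp f : smooth f -> L2v U (grad f) -> L2 U (partial i f).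
  by move=> sf /(_ i) Lf; refine (L2_eq_on mU _ Lf) => x _; rewrite mxE.
apply/eqP; rewrite -subr_eq0 opprK -RintegralD//; first last.
- exact/L2M_integrable/Lphi/Lp.
- exact/L2M_integrable/Lp.
pose g x := psi x * partial i phi x + partial i psi x * phi x.
have g0 x : ~ U x -> g x = 0.
  by move=> Ux; rewrite /g (test_fun_eq0 tphi)// (test_fun_partial_eq0 _ tphi)// !mulr0 addr0.
have cg : continuous g.
  have c1 : continuous psi by exact: smooth_continuous.
  have c2 : continuous phi by exact: smooth_continuous.
  have c3 : continuous (partial i phi) by exact: smooth_continuous_partial.
  have c4 : continuous (partial i psi) by exact: smooth_continuous_partial.
  by move=> x; exact: cvgD (cvgM (c1 x) (c3 x)) (cvgM (c4 x) (c2 x)).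
have [C gC] := continuous_bounded_compact cg (@compact_box B).
rewrite /Rintegral -/g integral_mkcond.
rewrite (_ : _ \_ U = EFin \o g); last first.
  apply/funext => x; rewrite patchE; case: ifPn => //.
  by rewrite notin_setE => /g0 /= ->.
rewrite (_ : integral _ _ _ = 0%E)//.
apply: (@integral_derive_eq0 _ _ i (fun x => psi x * phi x) g B C) => //.
- move=> x; have [/UB/gC//|Ux] := pselect (U x).
  (* [C] bounds [g] on the box only. It is nonnegative because the box contains the nonempty set
     [U]. *)
  rewrite g0// normr0; have [//|C0] := leP 0 C.
  have [y Uy] : U !=set0 by case: pU.
  by have := le_lt_trans (gC y (UB _ Uy)) C0; rewrite normr_lt0.
- move=> x.
  have dpsi := @smooth_is_derive psi i x spsi; have dphi := @smooth_is_derive phi i x sphi.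
  rewrite (_ : g x = psi x *: partial i phi x + phi x *: partial i psi x).
    exact: (is_deriveM dpsi dphi).
  by rewrite /g [in RHS]/GRing.scale/= (mulrC (phi x)).
- by move=> x xB; rewrite (test_fun_eq0 tphi) ?mulr0// => /UB.
- by move=> x xB; apply: g0 => /UB.
Qed.

Lemma H1_smooth U psi : polyhedral_domain U -> smooth psi -> H1 U (psi, grad psi).
Proof.
move=> pU spsi.
have mU := polyhedral_domain_measurable pU; have Uoo := polyhedral_domain_lty pU.
have [B UB] := polyhedral_domain_box pU.
have [Lpsi Lgpsi] := smooth_L2 spsi mU Uoo UB; split => // phi tphi i /=.
rewrite integral_partial_by_parts//; congr (- _).
by apply: eq_Rintegral => x _; rewrite mxE.
Qed.

End test_functions.

Section sobolev_spaces.
Variables (R : realType) (n : nat) (U : set 'rV[R]_n).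
Hypothesis pU : polyhedral_domain U.
Local Notation leb := (lebesgue_rV R n).

Let mU : measurable U := polyhedral_domain_measurable pU.
Let Uoo : (leb U < +oo)%E := polyhedral_domain_lty pU.

(** Cauchy-Schwarz against the constant 1, read off the integral of (V f - I)^2. Dividing by V
    requires V > 0; if V = 0, the integral I is over a null set. *)
Lemma Rintegral_sqr_le f : L2 U f ->
  (\int[leb]_(x in U) f x) ^+ 2 <= fine (leb U) * \int[leb]_(x in U) f x ^+ 2.
Proof.
move=> Lf; have fi := L2_integrable mU Uoo Lf; have [mf f2i] := Lf.
set I := \int[leb]_(x in U) f x; set J := \int[leb]_(x in U) f x ^+ 2.
set V := fine (leb U).
have : 0 <= \int[leb]_(x in U) (V * f x - I) ^+ 2.
  by apply: Rintegral_ge0 => x _; exact: sqr_ge0.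
have -> : \int[leb]_(x in U) (V * f x - I) ^+ 2 = V * (V * J - I ^+ 2).
  transitivity (\int[leb]_(x in U) (V ^+ 2 * f x ^+ 2 + (- (2 * V * I) * f x + I ^+ 2))).
    by apply: eq_Rintegral => x _; ring.
  have ci : leb.-integrable U (EFin \o cst (I ^+ 2)).
    by apply: L2_integrable => //; exact: L2_cst.
  have Zi (a : R) g : leb.-integrable U (EFin \o g) ->
      leb.-integrable U (EFin \o (fun x => a * g x)).
    by move=> gi; have := integrableZl mU a gi; apply: eq_integrable.
  have i2 : leb.-integrable U (EFin \o (fun x => - (2 * V * I) * f x + I ^+ 2)).
    by have := integrableD mU (Zi (- (2 * V * I)) _ fi) ci; apply: eq_integrable.
  rewrite (RintegralD mU (Zi (V ^+ 2) _ f2i) i2) (RintegralZl _ mU f2i).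
  rewrite (RintegralD mU (Zi _ _ fi) ci) (RintegralZl _ mU fi) Rintegral_cst//.
  rewrite -/I -/J -/V; ring.
have V0 : 0 <= V by exact: fine_ge0.
move: V0; rewrite le_eqVlt => /predU1P[V0 _|V0].
  have U0 : leb U = 0%E by apply/eqP; rewrite -fine_eq0 ?ge0_fin_numE// -/V -V0.
  rewrite -V0 mul0r /I /Rintegral null_set_integral ?expr0n//.
  exact/measurable_EFinP.
by rewrite pmulr_rge0// subr_ge0.
Qed.

Lemma test_fun_L2 phi i : test_fun U phi -> L2 U phi /\ L2 U (partial i phi).
Proof.
move=> [sphi _ _]; have [B UB] := polyhedral_domain_box pU.
have [Lphi /(_ i) Lg] := smooth_L2 sphi mU Uoo UB; split => //.
by refine (L2_eq_on mU _ Lg) => x _; rewrite mxE.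
Qed.

Lemma H1_add_scale (a : R) v w : H1 U v -> H1 U w -> H1 U (add_scale a v w).
Proof.
move=> [v1 v2 vw] [w1 w2 ww]; split; first exact/L2D/w1/L2Z.
  move=> i; refine (L2_eq_on mU _ (L2D mU (L2Z mU a (v2 i)) (w2 i))) => x _.
  by rewrite !mxE.
move=> phi tphi i; have [Lphi Lp] := test_fun_L2 i tphi.
have Zi (f g : 'rV[R]_n -> R) : L2 U f -> L2 U g ->
    \int[leb]_(x in U) (a * (f x * g x)) = a * \int[leb]_(x in U) (f x * g x) /\
    leb.-integrable U (EFin \o (fun x => a * (f x * g x))).
  move=> Lf Lg; have fgi := L2M_integrable mU Lf Lg; split.
    by rewrite (RintegralZl _ mU fgi).
  by have := integrableZl mU a fgi; apply: eq_integrable.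
transitivity (\int[leb]_(x in U) (a * (v.1 x * partial i phi x) + w.1 x * partial i phi x)).
  by apply: eq_Rintegral => x _ /=; ring.
have [ve vi] := Zi _ _ v1 Lp.
rewrite (RintegralD mU vi (L2M_integrable mU w1 Lp)) ve vw// ww//.
transitivity (- \int[leb]_(x in U) (a * (v.2 x ord0 i * phi x) + w.2 x ord0 i * phi x)).
  have [ve' vi'] := Zi _ _ (v2 i) Lphi.
  by rewrite (RintegralD mU vi' (L2M_integrable mU (w2 i) Lphi)) ve'; ring.
by congr (- _); apply: eq_Rintegral => x _ /=; rewrite !mxE; ring.
Qed.

Lemma H1_ae_eq0 (f : 'rV[R]_n -> R) : measurable_fun U f ->
  {ae leb, forall x, U x -> f x = 0} -> H1 U (f, cst 0).
Proof.
move=> mf f0; split.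
- refine (L2_eq_on mU _ (L2M_bounded mU (C := 0) mf _ (L2_cst mU 1 Uoo))).
    by move=> x _; rewrite mulr1.
  by apply: filterS f0 => x f0 Ux; rewrite f0// normr0.
- by move=> i; refine (L2_eq_on mU _ (L2_cst mU 0 Uoo)) => x _; rewrite mxE.
- move=> phi tphi i /=; have [Lphi [mp _]] := test_fun_L2 i tphi.
  transitivity (0 : R); last first.
    rewrite (_ : \int[leb]_(x in U) _ = \int[leb]_(x in U) (0 : R)).
      by rewrite Rintegral_cst// mul0r oppr0.
    by apply: eq_Rintegral => x _; rewrite mxE mul0r.
  rewrite /Rintegral (ae_eq_integral (cst 0%E))// ?integral0//.
    by apply/measurable_EFinP; exact: measurable_funM.
  by apply: filterS f0 => x f0 Ux; rewrite f0// mul0r.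
Qed.

End sobolev_spaces.

(** * Traces *)

Section traces.
Variables (R : realType) (d : nat) (Omega : set 'rV[R]_d) (M : mesh R d) (H h : R).
Variable tr : cell M -> ('rV[R]_d -> R) -> ('rV[R]_d -> R).
Hypotheses (hM : is_mesh M Omega H) (hfine : is_submesh M h) (htr : is_trace tr).
Local Notation leb := (lebesgue_rV R d).
Implicit Types (tau K : cell M) (F : face M) (e : subface M) (v w : sob R d).

Lemma elt_polyhedral tau : polyhedral_domain (elt tau).
Proof. by case: hM => [[]]. Qed.

Lemma pdom_polyhedral e : polyhedral_domain (pdom (subface_piece e)).
Proof. by case: hfine => /(_ e)[]. Qed.

Let mE tau : measurable (elt tau) := polyhedral_domain_measurable (elt_polyhedral tau).
Let mD e : measurable (pdom (subface_piece e)) :=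
  polyhedral_domain_measurable (pdom_polyhedral e).
Let Doo e := polyhedral_domain_lty (pdom_polyhedral e).

Lemma trace_L2 tau v e : H1 (elt tau) v -> subface_of e tau ->
  L2 (pdom (subface_piece e)) (tr tau v.1 \o pparam (subface_piece e)).
Proof. by case: (htr tau) => _ _ t _ /t; exact. Qed.

Lemma trace_integrable tau v e : H1 (elt tau) v -> subface_of e tau ->
  (lebesgue_rV R d.-1).-integrable (pdom (subface_piece e))
    (EFin \o (fun y => tr tau v.1 (pparam (subface_piece e) y))).
Proof. by move=> Hv et; exact: (L2_integrable (mD e) (Doo e) (trace_L2 Hv et)). Qed.

Lemma surf_int_ae_eq e (f g : 'rV[R]_d -> R) :
  measurable_fun (pdom (subface_piece e)) (f \o pparam (subface_piece e)) ->
  measurable_fun (pdom (subface_piece e)) (g \o pparam (subface_piece e)) ->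
  surf_ae (subface_piece e) (fun x => f x = g x) ->
  surf_int (subface_piece e) f = surf_int (subface_piece e) g.
Proof.
move=> mf mg fg; congr fine; apply: (ae_eq_integral _ _ (mD e)).
- exact/measurable_EFinP.
- exact/measurable_EFinP.
- by rewrite /surf_ae in fg; apply: filterS fg => y fg Dy /=; rewrite fg.
Qed.

Lemma trace_bound tau : exists2 C : R, 0 <= C & forall v, H1 (elt tau) v ->
  forall e, subface_of e tau ->
  surf_int (subface_piece e) (fun x => tr tau v.1 x ^+ 2) <= C * H1norm (elt tau) v ^+ 2.
Proof.
have [_ _ _ [C hC]] := htr tau; exists `|C| => // v Hv e et.
apply: (le_trans _ (le_trans (hC v Hv) _)); last first.
  by rewrite ler_wpM2r ?sqr_ge0// ler_norm.
rewrite (bigD1 e)//= lerDl sumr_ge0// => e' _.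
by apply: Rintegral_ge0 => y _; exact: sqr_ge0.
Qed.

(** The trace depends on [v.1] only, so the weak gradient may be replaced by 0. The new pair has
    norm zero, and the trace bound then makes the squared trace integrate to 0. No uniqueness of
    weak gradients is invoked. *)
Lemma trace_eq0 tau v : H1 (elt tau) v ->
  {ae leb, forall x, elt tau x -> v.1 x = 0} ->
  forall e, subface_of e tau -> surf_ae (subface_piece e) (fun x => tr tau v.1 x = 0).
Proof.
move=> [[mv _] _ _] v0 e et; pose w : sob R d := (v.1, cst 0).
have Hw : H1 (elt tau) w by exact: (H1_ae_eq0 (elt_polyhedral tau)).
have w0 : H1norm (elt tau) w = 0.
  rewrite /H1norm (_ : Rintegral _ _ _ = 0) ?sqrtr0//.
  rewrite /Rintegral (ae_eq_integral (cst 0%E))// ?integral0//.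
    apply/measurable_EFinP; apply: measurable_funD; first exact: measurable_funX.
    by apply: measurable_sum => i; apply: measurable_funM; exact: measurable_cst.
  apply: filterS v0 => x v0 /v0 /= ->; rewrite expr0n/= add0r /dotv big1//.
  by move=> i _; rewrite !mxE mul0r.
have [C _ /(_ w Hw e et)] := trace_bound tau.
rewrite w0 expr0n/= mulr0 /surf_int => int0.
have [mt t2i] := trace_L2 Hw et.
have int0' : (\int[lebesgue_rV R d.-1]_(y in pdom (subface_piece e))
    (tr tau v.1 (pparam (subface_piece e) y) ^+ 2)%:E = 0)%E.
  rewrite -[LHS]fineK; last exact: (integrable_fin_num (mD e)).
  congr EFin; apply/eqP; rewrite eq_le int0/=.
  by apply: fine_ge0; apply: integral_ge0 => y _; rewrite lee_fin sqr_ge0.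
have : ae_eq (lebesgue_rV R d.-1) (pdom (subface_piece e))
    (fun y => (tr tau v.1 (pparam (subface_piece e) y) ^+ 2)%:E) (cst 0%E).
  apply/ae_eq_integral_abs => //; first exact/measurable_EFinP/measurable_funX.
  rewrite -[RHS]int0'; apply: eq_integral => y _.
  by rewrite gee0_abs// lee_fin sqr_ge0.
apply: filterS => y y0 /y0/eqP; rewrite eqe sqrf_eq0 => /eqP; exact.
Qed.

Lemma trace_add_scale tau (a : R) v w e : H1 (elt tau) v -> H1 (elt tau) w ->
  subface_of e tau ->
  surf_int (subface_piece e) (tr tau (add_scale a v w).1) =
  a * surf_int (subface_piece e) (tr tau v.1) + surf_int (subface_piece e) (tr tau w.1).
Proof.
move=> Hv Hw et; have [_ /(_ a v w Hv Hw e et) lin _ _] := htr tau.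
have Ht := H1_add_scale (elt_polyhedral tau) a Hv Hw.
have [mt _] := trace_L2 Ht et; have [mv _] := trace_L2 Hv et; have [mw _] := trace_L2 Hw et.
have iv := trace_integrable Hv et; have iw := trace_integrable Hw et.
rewrite (surf_int_ae_eq mt _ lin).
  rewrite /surf_int RintegralD//; first by rewrite (RintegralZl _ _ iv).
  by have := integrableZl (mD e) a iv; apply: eq_integrable.
by apply: measurable_funD => //; exact: measurable_funM.
Qed.

Lemma surf_int_trace_eq tau v w e : H1 (elt tau) v -> H1 (elt tau) w ->
  {ae leb, forall x, elt tau x -> v.1 x = w.1 x} -> subface_of e tau ->
  surf_int (subface_piece e) (tr tau v.1) = surf_int (subface_piece e) (tr tau w.1).
Proof.
move=> Hv Hw vw et; apply/eqP; rewrite -subr_eq0 -[X in _ - X]mul1r -mulNr addrC.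
rewrite -trace_add_scale//; apply/eqP.
have Ht := H1_add_scale (elt_polyhedral tau) (- 1) Hw Hv.
have t0 : {ae leb, forall x, elt tau x -> (add_scale (- 1) w v).1 x = 0}.
  by apply: filterS vw => x vw /vw /= ->; rewrite mulN1r addNr.
have [mt _] := trace_L2 Ht et.
rewrite (surf_int_ae_eq mt _ (trace_eq0 Ht t0 et)).
  by rewrite /surf_int Rintegral_cst// mul0r.
exact: measurable_cst.
Qed.

Lemma pw_const_add_scale (c : coefs M) tau (a : R) v w :
  H1 (elt tau) v -> H1 (elt tau) w ->
  pw_const tr c tau (add_scale a v w).1 = a * pw_const tr c tau v.1 + pw_const tr c tau w.1.
Proof.
move=> Hv Hw; rewrite /pw_const mulr_sumr -big_split/=; apply: eq_bigr => e et.
by rewrite trace_add_scale//; ring.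
Qed.

Lemma pw_const_ae_eq (c : coefs M) tau v w : H1 (elt tau) v -> H1 (elt tau) w ->
  {ae leb, forall x, elt tau x -> v.1 x = w.1 x} ->
  pw_const tr c tau v.1 = pw_const tr c tau w.1.
Proof.
by move=> Hv Hw vw; apply: eq_bigr => e et; rewrite (surf_int_trace_eq Hv Hw vw et).
Qed.

(** This gives access to the equation of [T], which is available only for data in the dual of the
    trace space. *)
Lemma pw_const_Hmhalf (c : coefs M) tau : Hmhalf tr tau (pw_const tr c tau).
Proof.
split; first by move=> a v w; exact: pw_const_add_scale.
  have [C C0 hC] := trace_bound tau.
  (* On each subface, Cauchy-Schwarz bounds the squared integral of the trace by the area of [e]
     times the integral of the squared trace, which the trace bound controls by [C]. *)
  exists (\sum_(e | subface_of e tau) `|c tau e| *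
    Num.sqrt (fine (lebesgue_rV R d.-1 (pdom (subface_piece e))) * C)) => v Hv.
  rewrite mulr_suml (le_trans (ler_norm_sum _ _ _))//; apply: ler_sum => e et.
  rewrite normrM -mulrA ler_wpM2l//.
  have V0 : 0 <= fine (lebesgue_rV R d.-1 (pdom (subface_piece e))) by exact: fine_ge0.
  rewrite -(ler_pXn2r (n := 2)) ?nnegrE ?mulr_ge0 ?sqrtr_ge0//.
  rewrite exprMn sqr_sqrtr ?mulr_ge0// real_normK ?num_real//.
  rewrite (le_trans (Rintegral_sqr_le (pdom_polyhedral e) (trace_L2 Hv et)))//.
  by rewrite -mulrA ler_wpM2l//; exact: hC.
move=> v Hv t0; rewrite /pw_const big1// => e et.
have [mt _] := trace_L2 Hv et.
rewrite (surf_int_ae_eq mt _ (t0 e et)); last exact: measurable_cst.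
by rewrite /surf_int Rintegral_cst// mul0r mulr0.
Qed.

(** [v] is constant on [tau] only. It is exchanged for the globally constant function, which is
    smooth and so has a known trace. *)
Lemma pw_const_cst (c : coefs M) tau (a : R) v : H1 (elt tau) v ->
  (forall x, elt tau x -> v.1 x = a) ->
  pw_const tr c tau v.1 =
  a * \sum_(e | subface_of e tau) surf_int (subface_piece e) (cst (c tau e)).
Proof.
move=> Hv va; pose w : sob R d := (cst a, grad (cst a)).
have Hw : H1 (elt tau) w := H1_smooth (elt_polyhedral tau) (@smooth_cst _ _ a).
rewrite (pw_const_ae_eq c Hv Hw); last by apply: aeW => x /va.
rewrite /pw_const mulr_sumr; apply: eq_bigr => e et.
have [mw _] := trace_L2 Hw et.
have [/(_ (cst a) (@smooth_cst _ _ a) e et) ta _ _ _] := htr tau.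
rewrite (surf_int_ae_eq mw _ ta); last exact: measurable_cst.
rewrite /surf_int /= !Rintegral_cst//; ring.
Qed.

End traces.

(** * Energies and the lifting T *)

Section dot_products.
Variables (R : realType) (n : nat).
Implicit Types x y z : 'rV[R]_n.

Lemma dotvC x y : dotv x y = dotv y x.
Proof. by apply: eq_bigr => i _; rewrite mulrC. Qed.

Lemma dotvDZl (a : R) x y z : dotv (a *: x + y) z = a * dotv x z + dotv y z.
Proof.
by rewrite /dotv mulr_sumr -big_split/=; apply: eq_bigr => i _; rewrite !mxE; ring.
Qed.

Lemma dotvDZr (a : R) x y z : dotv z (a *: x + y) = a * dotv z x + dotv z y.
Proof. by rewrite dotvC dotvDZl !(dotvC z). Qed.

Lemma dotv_delta x i : dotv x (delta_mx ord0 i) = x ord0 i.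
Proof.
rewrite /dotv (bigD1 i)//= big1 => [|j ji]; rewrite !mxE ?eqxx ?mulr1 ?addr0//.
by rewrite (negPf ji) mulr0.
Qed.

Lemma fluxDZ (A : 'rV[R]_n -> 'M[R]_n) (a : R) x y z :
  flux A z (a *: x + y) = a *: flux A z x + flux A z y.
Proof. by rewrite /flux mulmxDl -scalemxAl. Qed.

Lemma flux_sym (A : 'rV[R]_n -> 'M[R]_n) x y z : (A z)^T = A z ->
  dotv (flux A z x) y = dotv (flux A z y) x.
Proof.
have dotE (u w : 'rV[R]_n) : dotv u w = (u *m w^T) ord0 ord0.
  by rewrite mxE; apply: eq_bigr => i _; rewrite mxE.
have trE (B : 'M[R]_1) : B^T ord0 ord0 = B ord0 ord0 by rewrite mxE.
by move=> sA; rewrite !dotE /flux -[RHS]trE !trmx_mul !trmxK sA mulmxA.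
Qed.

Lemma flux_delta (A : 'rV[R]_n -> 'M[R]_n) z i j :
  dotv (flux A z (delta_mx ord0 j)) (delta_mx ord0 i) = A z i j.
Proof. by rewrite dotv_delta /flux -rowE !mxE. Qed.

Lemma flux_coord (A : 'rV[R]_n -> 'M[R]_n) z x i :
  flux A z x ord0 i = \sum_j A z i j * x ord0 j.
Proof. by rewrite mxE; apply: eq_bigr => j _; rewrite mxE mulrC. Qed.

Variables (U : set 'rV[R]_n) (mU : measurable U).
Local Notation leb := (lebesgue_rV R n).

Lemma L2v_dot_integrable (p q : 'rV[R]_n -> 'rV[R]_n) : L2v U p -> L2v U q ->
  leb.-integrable U (EFin \o (fun x => dotv (p x) (q x))).
Proof.
move=> Lp Lq; have /(eq_integrable mU) : leb.-integrable U
    (fun x => (\sum_(i < n) (p x ord0 i * q x ord0 i)%:E)%E).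
  by apply: integrable_sum => // i _; exact: (L2M_integrable mU (Lp i) (Lq i)).
by apply => x _; rewrite sumEFin.
Qed.

End dot_products.

Section energy_form.
Variables (R : realType) (d : nat) (Omega : set 'rV[R]_d) (M : mesh R d).
Variables (A : 'rV[R]_d -> 'M[R]_d) (amin amax : R) (tau : cell M).
Hypothesis hA : is_coefficient Omega A amin amax.
Hypotheses (mO : measurable Omega) (mE : measurable (elt tau))
  (Eoo : (lebesgue_rV R d (elt tau) < +oo)%E) (EO : elt tau `<=` Omega).
Local Notation leb := (lebesgue_rV R d).
Implicit Types p q : sob R d.

Lemma coefficient_psd : {ae leb, forall x, Omega x -> (A x)^T = A x /\
  forall w, 0 <= dotv (flux A x w) w <= amax * dotv w w}.
Proof.
case: hA => amin0 _ _; apply: filterS => x hx Ox; have [sA {}hx] := hx Ox.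
split => // w; have [h1 h2 h3 h4] := hx w; rewrite (le_trans h3 h4) andbT.
rewrite (le_trans _ (le_trans h1 h2))// mulr_ge0//; first exact: ltW.
by apply: sumr_ge0 => i _; rewrite -expr2 sqr_ge0.
Qed.

(** Polarization: [A x i j] is a quarter of the difference of the quadratic form at e_j + e_i and at
    - e_j + e_i. Both values lie between 0 and [amax] times a squared length that is at most 4. *)
Lemma coefficient_bounded i j : {ae leb, forall x, Omega x -> `|A x i j| <= amax}.
Proof.
apply: filterS coefficient_psd => x hx Ox; have [sA {}hx] := hx Ox.
pose a : 'rV[R]_d := delta_mx ord0 j; pose b : 'rV[R]_d := delta_mx ord0 i.
have /andP[p0 p1] := hx (1 *: a + b); have /andP[m0 m1] := hx ((-1) *: a + b).
move: p0 p1 m0 m1; rewrite !fluxDZ !dotvDZl !dotvDZr (flux_sym b a sA).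
have -> : dotv (flux A x a) b = A x i j by exact: flux_delta.
have daa : dotv a a = 1 by rewrite dotv_delta mxE !eqxx.
have dbb : dotv b b = 1 by rewrite dotv_delta mxE !eqxx.
have /andP[dab0 dab1] : - 1 <= dotv a b <= 1.
  rewrite dotv_delta mxE eqxx/=; case: (i == j); rewrite /=; apply/andP; split; lra.
rewrite daa dbb (dotvC b a) => p0 p1 m0 m1.
have am0 : 0 < amax by case: hA.
have s1 : 0 <= amax * (1 - dotv a b) by rewrite mulr_ge0 ?subr_ge0// ltW.
have s2 : 0 <= amax * (1 + dotv a b) by rewrite mulr_ge0 -?lerBlDl ?sub0r// ltW.
rewrite ler_norml; apply/andP; split; lra.
Qed.

Lemma flux_L2v (p : 'rV[R]_d -> 'rV[R]_d) : L2v (elt tau) p ->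
  L2v (elt tau) (fun x => flux A x (p x)).
Proof.
move=> Lp i; have mA k l : measurable_fun (elt tau) (fun x => A x k l).
  by case: hA => _ _ mA _; exact: measurable_funS (mA k l).
have LA j : L2 (elt tau) (fun x => A x i j * p x ord0 j).
  refine (@L2M_bounded _ _ _ mE _ _ amax (mA i j) _ (Lp j)).
  by apply: filterS (coefficient_bounded i j) => x hx /EO/hx.
by refine (L2_eq_on mE _ (L2_sum mE (index_enum 'I_d) Eoo LA)) => x _; rewrite flux_coord.
Qed.

Definition energy_form p q : R :=
  \int[leb]_(x in elt tau) dotv (flux A x (p.2 x)) (q.2 x).

Lemma energy_form_integrable p q : L2v (elt tau) p.2 -> L2v (elt tau) q.2 ->
  leb.-integrable (elt tau) (EFin \o (fun x => dotv (flux A x (p.2 x)) (q.2 x))).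
Proof. by move=> /flux_L2v Lp Lq; exact: L2v_dot_integrable. Qed.

Lemma energy_form_sym p q : L2v (elt tau) p.2 -> L2v (elt tau) q.2 ->
  energy_form p q = energy_form q p.
Proof.
move=> Lp Lq; have ipq := energy_form_integrable Lp Lq.
have iqp := energy_form_integrable Lq Lp.
congr fine; apply: (ae_eq_integral _ _ mE); [exact: measurable_int ipq|exact: measurable_int iqp|].
apply: filterS coefficient_psd => x hx /EO /hx[sA _].
by rewrite /= flux_sym.
Qed.

Lemma energy_ge0 p : L2v (elt tau) p.2 -> 0 <= energy A tau p.
Proof.
move=> Lp; have ip := energy_form_integrable Lp Lp.
rewrite /energy (_ : Rintegral _ _ _ =
  \int[leb]_(x in elt tau) `|dotv (flux A x (p.2 x)) (p.2 x)|).
  by apply: Rintegral_ge0.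
congr fine; apply: (ae_eq_integral _ _ mE).
- exact: measurable_int ip.
- by have /measurable_int := integrable_norm ip.
- apply: filterS coefficient_psd => x hx /EO /hx[_ /(_ (p.2 x)) /andP[p0 _]].
  by rewrite ger0_norm.
Qed.

(** This is the energy of p + t q, expanded. It replaces the Cauchy-Schwarz inequality: t = 1 serves
    for the layer between patches, another t for lifts of zero energy. *)
Lemma energy_form_quad p q (t : R) : L2v (elt tau) p.2 -> L2v (elt tau) q.2 ->
  0 <= energy A tau p + 2 * t * energy_form p q + t ^+ 2 * energy A tau q.
Proof.
move=> Lp Lq; have Lpq : L2v (elt tau) (add_scale t q p).2.
  by move=> i; refine (L2_eq_on mE _ (L2D mE (L2Z mE t (Lq i)) (Lp i))) => x _; rewrite !mxE.
have ipp := energy_form_integrable Lp Lp; have iqq := energy_form_integrable Lq Lq.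
have ipq := energy_form_integrable Lp Lq; have iqp := energy_form_integrable Lq Lp.
have Zi (a : R) g : leb.-integrable (elt tau) (EFin \o g) ->
    leb.-integrable (elt tau) (EFin \o (fun x => a * g x)).
  by move=> gi; have := integrableZl mE a gi; apply: eq_integrable.
have Di f g : leb.-integrable (elt tau) (EFin \o f) -> leb.-integrable (elt tau) (EFin \o g) ->
    leb.-integrable (elt tau) (EFin \o (fun x => f x + g x)).
  by move=> fi gi; have := integrableD mE fi gi; apply: eq_integrable.
have := energy_ge0 Lpq; rewrite /energy.
under eq_Rintegral do rewrite /= fluxDZ dotvDZl !dotvDZr.
rewrite (RintegralD mE (Zi t _ (Di _ _ (Zi t _ iqq) iqp)) (Di _ _ (Zi t _ ipq) ipp)).
rewrite (RintegralZl _ mE (Di _ _ (Zi t _ iqq) iqp)) (RintegralD mE (Zi t _ iqq) iqp).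
rewrite (RintegralD mE (Zi t _ ipq) ipp) (RintegralZl _ mE iqq) (RintegralZl _ mE ipq).
rewrite -!/(energy_form _ _) (energy_form_sym Lq Lp) => h.
by apply: (le_trans h); rewrite le_eqVlt; apply/orP; left; apply/eqP; ring.
Qed.

End energy_form.

Section localization.
Variables (R : realType) (n : nat).
Implicit Types (U V : set 'rV[R]_n) (f g : 'rV[R]_n -> R).
Local Notation leb := (lebesgue_rV R n).

Lemma L2_patch U V f : measurable U -> measurable V -> U `<=` V -> L2 U f -> L2 V (f \_ U).
Proof.
move=> mU mV UV [mf fi]; have VU : V `&` U = U by exact/setIidPr.
split; first by apply/(measurable_restrict _ mU mV); rewrite VU.
have : leb.-integrable V ((fun x => (f x ^+ 2)%:E) \_ U).
  by apply/(integrable_restrict _ mU mV); rewrite VU.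
apply: eq_integrable => // x _; rewrite !patchE; case: ifP => //.
by rewrite expr0n.
Qed.

Lemma H1_eq_on U (v w : sob R n) : measurable U ->
  (forall x, U x -> v.1 x = w.1 x /\ v.2 x = w.2 x) -> H1 U v -> H1 U w.
Proof.
move=> mU vw [v1 v2 vi]; split.
- by refine (L2_eq_on mU _ v1) => x /vw[].
- by move=> i; refine (L2_eq_on mU _ (v2 i)) => x /vw[_ ->].
- move=> phi tphi i.
  transitivity (- \int[leb]_(x in U) (v.2 x ord0 i * phi x)).
    by rewrite -vi//; apply: eq_Rintegral => x /[!inE] /vw[-> _].
  by congr (- _); apply: eq_Rintegral => x /[!inE] /vw[_ ->].
Qed.

Lemma grad_cst (a : R) x : grad (cst a : 'rV[R]_n -> R) x = 0.
Proof. by apply/rowP => i; rewrite !mxE /partial derive_cst. Qed.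

Lemma Rintegral_sum (I : Type) (s : seq I) U (f : I -> 'rV[R]_n -> R) : measurable U ->
  (forall i, leb.-integrable U (EFin \o f i)) ->
  \int[leb]_(x in U) (\sum_(i <- s) f i x) = \sum_(i <- s) \int[leb]_(x in U) f i x.
Proof.
move=> mU fi; elim: s => [|i s IH].
  by under eq_Rintegral do rewrite big_nil; rewrite Rintegral_cst// mul0r big_nil.
under eq_Rintegral do rewrite big_cons.
rewrite RintegralD// ?IH ?big_cons//.
have : leb.-integrable U (fun x => (\sum_(i <- s) (f i x)%:E)%E).
  by apply: integrable_sum => // k _; exact: fi.
by apply: eq_integrable => // x _; rewrite sumEFin.
Qed.

End localization.

(** * The equation of T for balanced data *)

Section elliptic_lifting.
Variables (R : realType) (d : nat) (Omega : set 'rV[R]_d) (M : mesh R d) (H h : R).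
Variable tr : cell M -> ('rV[R]_d -> R) -> ('rV[R]_d -> R).
Hypotheses (pO : polyhedral_domain Omega) (hM : is_mesh M Omega H).
Hypotheses (hfine : is_submesh M h) (htr : is_trace tr).
Variables (A : 'rV[R]_d -> 'M[R]_d) (amin amax : R).
Hypothesis hA : is_coefficient Omega A amin amax.
Variable T : bdata M -> sob R d.
Hypothesis hT : is_T Omega tr A T.
Local Notation leb := (lebesgue_rV R d).
Implicit Types (tau K : cell M) (F : face M) (e : subface M) (v w : sob R d) (c : coefs M).

Lemma elt_sub tau : elt tau `<=` Omega.
Proof. by case: hM => [[]]. Qed.

Lemma elt_disjoint tau tau' x : elt tau x -> elt tau' x -> tau = tau'.
Proof.
case: hM => [[_ _ dis _ _] _ _] tx t'x; apply: contrapT => /eqP/dis tt'.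
by have : (elt tau `&` elt tau') x by []; rewrite tt'.
Qed.

Let pE tau : polyhedral_domain (elt tau) := elt_polyhedral hM tau.
Let mE tau : measurable (elt tau) := polyhedral_domain_measurable (pE tau).
Let Eoo tau := polyhedral_domain_lty (pE tau).
Let mO : measurable Omega := polyhedral_domain_measurable pO.

(** The compatibility condition of the Neumann problem on [tau]: the data annihilate constants. *)
Definition balanced c tau :=
  \sum_(e | subface_of e tau) surf_int (subface_piece e) (cst (c tau e)) = 0.

Lemma T_broken c : broken_H1_0 M Omega (T (pw_const tr c)).
Proof. by have [] := hT (fun tau => pw_const_Hmhalf hM hfine htr c tau). Qed.

Lemma T_L2v c tau : L2v (elt tau) (T (pw_const tr c)).2.
Proof. by have [[_ /(_ tau)[]]] := T_broken c. Qed.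

Lemma T_pairing_broken c w tau : broken_H1_0 M Omega w ->
  \int[leb]_(x in elt tau) dotv (flux A x ((T (pw_const tr c)).2 x)) (w.2 x) =
  pw_const tr c tau w.1.
Proof.
by move=> Hw; have [_ ] := hT (fun tau => pw_const_Hmhalf hM hfine htr c tau); exact.
Qed.

(* The test function is made admissible by subtracting its mean over [tau],
   which balanced data do not see. *)
Lemma T_pairing c v tau : balanced c tau -> H1 (elt tau) v ->
  \int[leb]_(x in elt tau) dotv (flux A x ((T (pw_const tr c)).2 x)) (v.2 x) =
  pw_const tr c tau v.1.
Proof.
move=> bc Hv; pose m := \int[leb]_(x in elt tau) v.1 x / fine (leb (elt tau)).
pose one : sob R d := (cst 1, grad (cst 1)).
have H1one : H1 (elt tau) one := H1_smooth (pE tau) (@smooth_cst _ _ 1).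
pose u := add_scale (- m) one v.
have Hu : H1 (elt tau) u := H1_add_scale (pE tau) (- m) H1one Hv.
(* Nothing is known of [v] off [tau], whereas a test function must belong to the broken space on all
   of [Omega]; hence the extension by zero. *)
pose w : sob R d := (u.1 \_ (elt tau), fun x => if x \in elt tau then u.2 x else 0).
have wu x : elt tau x -> w.1 x = u.1 x /\ w.2 x = u.2 x.
  by move=> tx; rewrite /w/= !patchE mem_set.
have Hw : H1 (elt tau) w by apply: H1_eq_on Hu => // x /wu[-> ->].
have vi : leb.-integrable (elt tau) (EFin \o v.1).
  by case: Hv => Lv _ _; exact: (L2_integrable (mE tau) (@Eoo tau)).
have Bw : broken_H1_0 M Omega w.
  split; first split.
  - by case: Hu => Lu _ _; exact: (L2_patch (mE tau) mO (@elt_sub tau)).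
  - move=> tau'; have [->//|tt'] := eqVneq tau' tau.
    have mz : measurable_fun (elt tau') (cst 0 : 'rV[R]_d -> R) by exact: measurable_cst.
    apply: H1_eq_on (H1_ae_eq0 (pE tau') mz _) => //; last exact: aeW.
    move=> x t'x; rewrite /w/= !patchE memNset// => tx.
    by rewrite (elt_disjoint t'x tx) eqxx in tt'.
  move=> tau'; have [->|tt'] := eqVneq tau' tau; last first.
    rewrite -[RHS](mul0r (fine (leb (elt tau')))) -Rintegral_cst//.
    apply: eq_Rintegral => x /[!inE] t'x; rewrite /w/= patchE memNset// => tx.
    by rewrite (elt_disjoint t'x tx) eqxx in tt'.
  transitivity (\int[leb]_(x in elt tau) (- m + v.1 x)).
    by apply: eq_Rintegral => x /[!inE] /wu[-> _]; rewrite /= mulr1.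
  have ci : leb.-integrable (elt tau) (EFin \o cst (- m)).
    by apply: (L2_integrable (mE tau) (@Eoo tau)); exact: (L2_cst (mE tau) _ (@Eoo tau)).
  rewrite (RintegralD (mE tau) ci vi) Rintegral_cst// /m.
  have [V0|V0] := eqVneq (fine (leb (elt tau))) 0; last by rewrite mulNr divfK// addNr.
  have U0 : leb (elt tau) = 0%E by apply/eqP; rewrite -fine_eq0 ?ge0_fin_numE//; exact/eqP.
  rewrite V0 mulr0 add0r /Rintegral null_set_integral//.
  exact: measurable_int vi.
transitivity (\int[leb]_(x in elt tau) dotv (flux A x ((T (pw_const tr c)).2 x)) (w.2 x)).
  apply: eq_Rintegral => x /[!inE] /wu[_ ->].
  by rewrite /= grad_cst scaler0 add0r.
rewrite (T_pairing_broken c tau Bw) (pw_const_ae_eq hM hfine htr c Hw Hu); last first.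
  by apply: aeW => x /wu[].
rewrite (pw_const_add_scale hM hfine htr)// (pw_const_cst hM hfine htr c (a := 1) H1one)//.
by rewrite [X in _ * (_ * X)]bc !mulr0 add0r.
Qed.

End elliptic_lifting.

(** * Data carried by a set of faces *)

Section cutoff_data.
Variables (R : realType) (d : nat) (Omega : set 'rV[R]_d) (M : mesh R d) (H h : R).
Variable tr : cell M -> ('rV[R]_d -> R) -> ('rV[R]_d -> R).
Hypotheses (pO : polyhedral_domain Omega) (hM : is_mesh M Omega H).
Hypotheses (hfine : is_submesh M h) (htr : is_trace tr).
Variables (A : 'rV[R]_d -> 'M[R]_d) (amin amax : R).
Hypothesis hA : is_coefficient Omega A amin amax.
Variable T : bdata M -> sob R d.
Hypothesis hT : is_T Omega tr A T.
Local Notation leb := (lebesgue_rV R d).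
Implicit Types (tau K : cell M) (F : face M) (e : subface M) (v w : sob R d) (c : coefs M).

Let pE tau : polyhedral_domain (elt tau) := elt_polyhedral hM tau.
Let mE tau : measurable (elt tau) := polyhedral_domain_measurable (pE tau).
Let Eoo tau := polyhedral_domain_lty (pE tau).
Let mO : measurable Omega := polyhedral_domain_measurable pO.

Lemma subface_in_inj e F F' : subface_in e F -> subface_in e F' -> F = F'.
Proof.
move=> /asboolP eF /asboolP eF'; apply: contrapT => /eqP FF'.
have [_ [_ dis _] _] := hM; have [y Dy] : pdom (subface_piece e) !=set0.
  by case: (pdom_polyhedral hfine e).
have ex : carrier (subface_piece e) (pparam (subface_piece e) y) by exists y.
have := dis F F' FF'; apply/eqP/set0P.
by exists (pparam (subface_piece e) y); split; [exact: eF|exact: eF'].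
Qed.

Lemma subface_ofE e F tau : subface_in e F -> subface_of e tau = face_of F tau.
Proof.
move=> eF; apply/existsP/idP => [[F' /andP[/(subface_in_inj eF) <-]]//|Ft].
by exists F; rewrite eF.
Qed.

Lemma sum_subface_of tau (g : subface M -> R) :
  \sum_(e | subface_of e tau) g e =
  \sum_(F | face_of F tau) \sum_(e | subface_in e F) g e.
Proof.
rewrite (exchange_big_dep (fun e => subface_of e tau))/=; last first.
  by move=> F e Ft eF; rewrite (subface_ofE tau eF).
apply: eq_bigr => e /existsP[F /andP[eF Ft]].
rewrite (big_pred1 F)// => F'; apply/andP/eqP => [[_ eF']|->//].
exact: subface_in_inj eF' eF.
Qed.

(** Unlike [chi], which lives on the boundary of a single element, this keeps or drops a face on
    both of its sides, so the sign rule on interior faces survives. *)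
Definition cutoff (G : pred (face M)) c : coefs M := fun tau e =>
  if [exists F, G F && subface_in e F] then c tau e else 0.

Lemma cutoffE (G : pred (face M)) c tau e F : subface_in e F ->
  cutoff G c tau e = if G F then c tau e else 0.
Proof.
move=> eF; rewrite /cutoff; congr (if _ then _ else _).
apply/existsP/idP => [[F' /andP[GF' /(subface_in_inj eF) ->]]//|GF].
by exists F; rewrite GF.
Qed.

Lemma balanced_face c tau :
  (forall F, face_of F tau ->
    \sum_(e | subface_in e F) surf_int (subface_piece e) (cst (c tau e)) = 0) ->
  balanced c tau.
Proof. by move=> cF; rewrite /balanced sum_subface_of big1// => F /cF. Qed.

Lemma surf_int_cst0 e : surf_int (subface_piece e) (cst 0) = 0.
Proof.
rewrite /surf_int Rintegral_cst ?mul0r//.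
exact: polyhedral_domain_measurable (pdom_polyhedral hfine e).
Qed.

Lemma surf_int_test_eq0 phi e F tau : test_fun Omega phi -> subface_in e F ->
  carrier (face_piece F) `<=` bnd Omega -> face_of F tau ->
  surf_int (subface_piece e) (tr tau phi) = 0.
Proof.
move=> tphi eF FO Ft; have [sphi _ _] := tphi.
have et : subface_of e tau by rewrite (subface_ofE tau eF).
rewrite -(surf_int_cst0 e).
have [mt _] := trace_L2 htr (H1_smooth (pE tau) sphi) et.
apply: (surf_int_ae_eq hfine mt); first exact: measurable_cst.
have [/(_ phi sphi e et) + _ _ _] := htr tau; rewrite /surf_ae.
apply: filterS => y tE Dy; rewrite tE// (test_fun_eq0 tphi)//.
have /FO[_] : carrier (face_piece F) (pparam (subface_piece e) y).
  by move/asboolP : eF; apply; exists y.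
by rewrite (interior_id _).1//; exact: polyhedral_domain_open.
Qed.

Lemma surf_int_test_eq phi e tau tau' : smooth phi -> subface_of e tau -> subface_of e tau' ->
  surf_int (subface_piece e) (tr tau phi) = surf_int (subface_piece e) (tr tau' phi).
Proof.
move=> sphi et et'.
have [mt _] := trace_L2 htr (H1_smooth (pE tau) sphi) et.
have [mt' _] := trace_L2 htr (H1_smooth (pE tau') sphi) et'.
apply: (surf_int_ae_eq hfine mt mt').
have [/(_ phi sphi e et) + _ _ _] := htr tau.
have [/(_ phi sphi e et') + _ _ _] := htr tau'; rewrite /surf_ae.
by apply: filterS2 => y t'E tE Dy; rewrite tE// t'E.
Qed.

(* The contributions of the two sides of an interior face cancel, and a test
   function vanishes on the boundary faces. *)
Lemma pairing_test_eq0 c phi : test_fun Omega phi ->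
  (forall tau tau' e, tau != tau' -> subface_of e tau -> subface_of e tau' ->
    c tau e = - c tau' e) ->
  pairing (pw_const tr c) phi = 0.
Proof.
move=> tphi csign; have [sphi _ _] := tphi.
rewrite /pairing /pw_const (exchange_big_dep xpredT)//= big1// => e _.
have [F eF] : exists F, subface_in e F by case: hfine.
under eq_bigl do rewrite (subface_ofE _ eF).
have [_ _ /(_ F)[[FO _]|[_ F2]]] := hM.
  by rewrite big1// => tau Ft; rewrite (surf_int_test_eq0 tphi eF FO Ft) mulr0.
have /cards2P[t1 [t2 [t12 Ft]]] : #|[set tau | face_of F tau]%SET| == 2%N.
  by rewrite cardsE F2.
rewrite (eq_bigl (fun t => t \in [set t1; t2]%SET)); last by move=> t; rewrite -Ft inE.
have e1 : subface_of e t1.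
  by rewrite (subface_ofE _ eF); move/setP/(_ t1): Ft; rewrite finset.in_set set21.
have e2 : subface_of e t2.
  by rewrite (subface_ofE _ eF); move/setP/(_ t2): Ft; rewrite finset.in_set set22.
rewrite big_setU1 ?inE//= big_set1 (csign _ _ _ t12 e1 e2).
by rewrite (surf_int_test_eq sphi e1 e2) mulNr addNr.
Qed.

(** Green's formula against constants forces zero total flux through each boundary once the
    divergence is 0; balance is this condition, and it turns the equation of [T] into Green's
    formula for every H^1 function on the element. *)
Lemma pw_const_Lambda c :
  (forall tau tau' e, tau != tau' -> subface_of e tau -> subface_of e tau' ->
    c tau e = - c tau' e) ->
  (forall tau, balanced c tau) -> Lambda Omega (pw_const tr c).
Proof.
move=> csign cbal; pose flx x := flux A x ((T (pw_const tr c)).2 x).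
(* Elements are disjoint, so at most one term is nonzero; off the elements the field is 0. *)
pose s x : 'rV[R]_d := \sum_(tau : cell M) if x \in elt tau then flx x else 0.
have sE tau x : elt tau x -> s x = flx x.
  move=> tx; rewrite /s (bigD1 tau)//= mem_set// big1 ?addr0// => t' t't.
  by rewrite memNset// => t'x; rewrite (elt_disjoint hM tx t'x) eqxx in t't.
have Lf tau : L2v (elt tau) flx.
  apply: (flux_L2v hA mO (mE tau) (@Eoo tau) (elt_sub hM (tau := tau))).
  exact: (T_L2v hM hfine htr hT).
have OE tau : Omega `&` elt tau = elt tau.
  by apply/setIidPr; exact: (elt_sub hM (tau := tau)).
have Ooo : (leb Omega < +oo)%E by exact: polyhedral_domain_lty.
exists (s, cst 0).
  split.
  - move=> i.
    have Lt tau : L2 Omega ((fun x => flx x ord0 i) \_ (elt tau)).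
      exact: (L2_patch (mE tau) mO (elt_sub hM (tau := tau)) (Lf tau i)).
    refine (L2_eq_on mO _ (L2_sum mO (index_enum (cell M)) Ooo Lt)) => x _.
    by rewrite /= summxE; apply: eq_bigr => t _; rewrite patchE; case: ifP; rewrite ?mxE.
  - exact: (L2_cst mO 0 Ooo).
  - move=> phi tphi /=; have [sphi _ _] := tphi.
    have [B OB] := polyhedral_domain_box pO.
    have Lg tau : L2v (elt tau) (grad phi).
      apply: (smooth_L2 sphi (mE tau) (@Eoo tau) (B := B) _).2.
      exact: subset_trans (elt_sub hM (tau := tau)) OB.
    pose g x := dotv (flx x) (grad phi x).
    have gi tau : leb.-integrable Omega (EFin \o (g \_ (elt tau))).
      rewrite -restrict_EFin; apply/(integrable_restrict _ (mE tau) mO).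
      by rewrite OE; exact: L2v_dot_integrable.
    transitivity (\int[leb]_(x in Omega) \sum_(tau : cell M) (g \_ (elt tau)) x).
      apply: eq_Rintegral => x _; rewrite /dotv.
      rewrite (eq_bigr (fun i => \sum_(tau : cell M)
        (if x \in elt tau then flx x ord0 i * grad phi x ord0 i else 0))); last first.
        move=> i _; rewrite summxE mulr_suml; apply: eq_bigr => t _.
        by case: ifP; rewrite ?mxE ?mul0r.
      rewrite exchange_big/=; apply: eq_bigr => t _; rewrite patchE; case: ifP => // _.
      by rewrite big1.
    rewrite Rintegral_sum//.
    transitivity (pairing (pw_const tr c) phi).
      apply: eq_bigr => tau _; rewrite -Rintegral_mkcondr.
      rewrite OE.
      exact: (T_pairing pO hM hfine htr hT (cbal tau) (H1_smooth (pE tau) sphi)).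
    rewrite (pairing_test_eq0 tphi csign).
    under eq_Rintegral do rewrite mul0r.
    by rewrite Rintegral_cst// mul0r oppr0.
move=> tau v Hv; rewrite -(T_pairing pO hM hfine htr hT (cbal tau) Hv).
by apply: eq_Rintegral => x /[!inE] tx /=; rewrite (sE _ _ tx) mul0r addr0.
Qed.

(** Here the zero mean on each single face is decisive: data that are only balanced on each element
    boundary would lose their balance when some faces are dropped. *)
Lemma cutoff_tLambda_h_f (G : pred (face M)) c : tLambda_h_f Omega tr c ->
  tLambda_h_f Omega tr (cutoff G c).
Proof.
move=> [[[_ csign] _] cF].
have kF tau F : face_of F tau ->
    \sum_(e | subface_in e F) surf_int (subface_piece e) (cst (cutoff G c tau e)) = 0.
  move=> Ft; have [GF|GF] := boolP (G F).
    rewrite -[RHS](cF tau F Ft); apply: eq_bigr => e eF.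
    by rewrite (cutoffE G c tau eF) GF.
  rewrite big1// => e eF.
  by rewrite (cutoffE G c tau eF) (negPf GF) surf_int_cst0.
have kbal tau : balanced (cutoff G c) tau by apply: balanced_face; exact: kF.
have ksign tau tau' e : tau != tau' -> subface_of e tau -> subface_of e tau' ->
    cutoff G c tau e = - cutoff G c tau' e.
  move=> tt' et et'; rewrite /cutoff; case: ifP => _; last by rewrite oppr0.
  exact: csign.
split; last exact: kF.
split; first by split; [exact: pw_const_Lambda|exact: ksign].
move=> v0 Pv0; rewrite /pairing big1// => tau _.
have [a va] := Pv0 tau; pose w : sob R d := (v0, grad (cst a)).
have Hw : H1 (elt tau) w.
  by apply: H1_eq_on (H1_smooth (pE tau) (@smooth_cst _ _ a)) => // x /va /= ->.
rewrite (pw_const_cst hM hfine htr _ Hw va).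
by rewrite [X in _ * X]kbal mulr0.
Qed.

End cutoff_data.

(** * Exponential decay *)

Section decay.
Variables (R : realType) (d : nat) (Omega : set 'rV[R]_d) (M : mesh R d) (H h : R).
Variable tr : cell M -> ('rV[R]_d -> R) -> ('rV[R]_d -> R).
Hypotheses (pO : polyhedral_domain Omega) (hM : is_mesh M Omega H).
Hypotheses (hfine : is_submesh M h) (htr : is_trace tr).
Variables (A : 'rV[R]_d -> 'M[R]_d) (amin amax : R).
Hypothesis hA : is_coefficient Omega A amin amax.
Variable T : bdata M -> sob R d.
Hypothesis hT : is_T Omega tr A T.
Variable alph : R.
Hypothesis halpha : forall (tau : cell M) (F : face M) (c : coefs M),
  face_of F tau -> tLambda_h_f Omega tr c ->
  energy A tau (T (pw_const tr (chi tau F c))) <= alph * energy A tau (T (pw_const tr c)).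
Local Notation leb := (lebesgue_rV R d).
Implicit Types (tau K : cell M) (F : face M) (e : subface M) (v w : sob R d) (c : coefs M).

Let pE tau : polyhedral_domain (elt tau) := elt_polyhedral hM tau.
Let mE tau : measurable (elt tau) := polyhedral_domain_measurable (pE tau).
Let Eoo tau := polyhedral_domain_lty (pE tau).
Let EO tau : elt tau `<=` Omega := elt_sub hM (tau := tau).
Let mO : measurable Omega := polyhedral_domain_measurable pO.
Let LT c tau : L2v (elt tau) (T (pw_const tr c)).2 := T_L2v hM hfine htr hT c tau.

Lemma energy_form_T c c' tau :
  energy_form A tau (T (pw_const tr c)) (T (pw_const tr c')) =
  pw_const tr c tau (T (pw_const tr c')).1.
Proof.
exact: (T_pairing_broken hM hfine htr hT c tau (T_broken hM hfine htr hT c')).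
Qed.

Lemma energy_T_ge0 c tau : 0 <= energy A tau (T (pw_const tr c)).
Proof. exact: (energy_ge0 hA mO (mE tau) (@Eoo tau) (@EO tau) (@LT c tau)). Qed.

(** Both energies equal the mixed energy of the two lifts, by the equation of [T] and the symmetry
    of the form. The data may differ on other elements, so the lifts need not be the same
    function. *)
Lemma energy_T_eq c c' tau : pw_const tr c tau =1 pw_const tr c' tau ->
  energy A tau (T (pw_const tr c)) = energy A tau (T (pw_const tr c')).
Proof.
move=> cc'; rewrite -[LHS]/(energy_form A tau _ _) -[RHS]/(energy_form A tau _ _).
rewrite energy_form_T cc' -energy_form_T.
rewrite (energy_form_sym hA mO (mE tau) (@Eoo tau) (@EO tau) (@LT _ tau) (@LT _ tau)).
by rewrite energy_form_T cc' -energy_form_T.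
Qed.

Lemma chi_cutoff tau F c : chi tau F (cutoff (pred1 F) c) = chi tau F c.
Proof.
apply/funext => tau'; apply/funext => e; rewrite /chi; case: ifP => // /andP[_ eF].
by rewrite (cutoffE hM hfine _ _ _ eF) /= eqxx.
Qed.

Lemma pw_const_chi tau F c f : face_of F tau ->
  pw_const tr (chi tau F c) tau f =
  \sum_(e | subface_in e F) c tau e * surf_int (subface_piece e) (tr tau f).
Proof.
move=> Ft; rewrite /pw_const big_mkcond [RHS]big_mkcond; apply: eq_bigr => e _.
rewrite /chi eqxx /=; case: ifPn => et; case: ifPn => eF //; first by rewrite mul0r.
by rewrite (subface_ofE hM hfine _ eF) Ft in et.
Qed.

Lemma pw_const_cutoff tau (G : pred (face M)) c f :
  pw_const tr (cutoff G c) tau f =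
  \sum_(F | face_of F tau && G F) pw_const tr (chi tau F c) tau f.
Proof.
rewrite /pw_const (sum_subface_of hM hfine) [RHS]big_mkcondr; apply: eq_bigr => F Ft.
rewrite -/(pw_const tr (chi tau F c) tau f) pw_const_chi//.
case: ifPn => GF; last rewrite big1//.
  by apply: eq_bigr => e eF; rewrite (cutoffE hM hfine _ _ _ eF) GF.
by move=> e eF; rewrite (cutoffE hM hfine _ _ _ eF) (negPf GF) mul0r.
Qed.

Lemma pw_const_faces tau c f :
  pw_const tr c tau f = \sum_(F | face_of F tau) pw_const tr (chi tau F c) tau f.
Proof.
rewrite [LHS]/pw_const (sum_subface_of hM hfine); apply: eq_bigr => F Ft.
by rewrite pw_const_chi.
Qed.

(** * Contributions of single faces to the energy *)

Variables (mu : coefs M) (hmu : tLambda_h_f Omega tr mu).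
Local Notation u := (T (pw_const tr mu)).

(** For data carried by [F] alone, multiplication by chi_F changes nothing on [tau], so the same
    energy stands on both sides of the hypothesis on [alph]. *)
Lemma energy_chi_le tau F : face_of F tau ->
  energy A tau (T (pw_const tr (chi tau F mu))) <=
  alph * energy A tau (T (pw_const tr (chi tau F mu))).
Proof.
move=> Ft; rewrite -[in leLHS]chi_cutoff.
have hc := cutoff_tLambda_h_f pO hM hfine htr hA hT (pred1 F) hmu.
rewrite (le_trans (halpha Ft hc))// le_eqVlt; apply/orP; left; apply/eqP; congr (_ * _).
apply: energy_T_eq => f; rewrite pw_const_cutoff pw_const_chi// (big_pred1 F).
  by rewrite pw_const_chi.
by move=> F' /=; apply/andP/eqP => [[_ /eqP]//|->]; split.
Qed.

Lemma energy_form_chi_eq0 tau F : face_of F tau ->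
  energy A tau (T (pw_const tr (chi tau F mu))) = 0 ->
  pw_const tr (chi tau F mu) tau u.1 = 0.
Proof.
move=> Ft e0; rewrite -energy_form_T; set b := energy_form _ _ _ _.
have E0 := energy_T_ge0 mu tau; set E := energy A tau u in E0.
have E1 : 0 < 1 + E by rewrite ltr_pwDl.
(* The parameter is - b / (1 + E), not - b / E, so that E = 0 needs no separate case. *)
have := energy_form_quad hA mO (mE tau) (@Eoo tau) (@EO tau) (- b / (1 + E))
  (@LT (chi tau F mu) tau) (@LT mu tau).
rewrite e0 -/b -/E add0r.
have -> : 2 * (- b / (1 + E)) * b + (- b / (1 + E)) ^+ 2 * E =
    - (b ^+ 2 * ((1 + E)^-1 + ((1 + E)^-1) ^+ 2)).
  by field; rewrite gt_eqF.
rewrite oppr_ge0 pmulr_lle0 ?addr_gt0 ?exprn_gt0 ?invr_gt0// => b2.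
by apply/eqP; rewrite -sqrf_eq0 eq_le b2 sqr_ge0.
Qed.

(** If [alph] < 1, [energy_chi_le] makes the energy of each single-face lift vanish. The energy of
    [u] on [tau] is the sum over the faces of the mixed energies of these lifts with [u], which then
    vanish too. *)
Lemma alpha_ge1_or_energy0 : 1 <= alph \/ forall tau, energy A tau u = 0.
Proof.
have [|a1] := leP 1 alph; [by left|right=> tau].
rewrite -[LHS]/(energy_form A tau u u) energy_form_T pw_const_faces big1// => F Ft.
apply: energy_form_chi_eq0 => //; apply/eqP; rewrite eq_le energy_T_ge0 andbT.
have := energy_chi_le Ft; rewrite -subr_le0 -[X in X - _]mul1r -mulrBl.
by rewrite pmulr_rle0// subr_gt0.
Qed.

(** With b the mixed energy and E that of [u], positivity at t = 1 gives 2 b >= - (alpha + 1) E, and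
    alpha >= 1 turns this into b >= - alpha E. Summing over at most N faces produces the factor N
    alpha. *)
Lemma pw_const_chi_ge tau F : 1 <= alph -> face_of F tau ->
  - (alph * energy A tau u) <= pw_const tr (chi tau F mu) tau u.1.
Proof.
move=> a1 Ft; rewrite -energy_form_T.
have := energy_form_quad hA mO (mE tau) (@Eoo tau) (@EO tau) 1
  (@LT (chi tau F mu) tau) (@LT mu tau).
have := halpha Ft hmu; have := energy_T_ge0 mu tau; nra.
Qed.

Lemma pw_const_cutoff_ge tau (G : pred (face M)) : 1 <= alph ->
  - ((max_faces M)%:R * alph * energy A tau u) <= pw_const tr (cutoff G mu) tau u.1.
Proof.
move=> a1; rewrite pw_const_cutoff.
apply: (@le_trans _ _ (\sum_(F | face_of F tau && G F) - (alph * energy A tau u))); last first.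
  by apply: ler_sum => F /andP[Ft _]; exact: pw_const_chi_ge.
rewrite sumr_const mulNrn lerN2 -mulrA -[leLHS]mulr_natl ler_wpM2r//.
  by rewrite mulr_ge0 ?energy_T_ge0// (le_trans ler01).
rewrite ler_nat (leq_trans _ (leq_bigmax tau))//.
by apply/subset_leq_card/fintype.subsetP => F; rewrite !unfold_in/= => /andP[].
Qed.

(** * Patches and the decay of the energy *)

Lemma cell_patchS j K : {subset cell_patch j K <= cell_patch j.+1 K}.
Proof.
case: j => [|j] tau; first by rewrite finset.in_set0.
move=> tj; rewrite [cell_patch j.+2 K]/= finset.in_set; apply/existsP; exists tau.
rewrite tj/=; apply/asboolP; have [x tx] : elt tau !=set0 by case: (pE tau).
by exists x; split; exact: subset_closure.
Qed.

Lemma cell_patch_self j K : (0 < j)%N -> K \in cell_patch j K.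
Proof.
by case: j => // j _; elim: j => [|j IH]; [rewrite /= set11|exact: cell_patchS].
Qed.

Lemma face_of_closure F tau : face_of F tau ->
  carrier (face_piece F) `<=` closure (elt tau).
Proof. by move=> /asboolP Ft x /Ft[]. Qed.

Lemma cell_patch_face j K F tau tau' : (0 < j)%N -> tau' \in cell_patch j K ->
  face_of F tau' -> face_of F tau -> tau \in cell_patch j.+1 K.
Proof.
case: j => // j _ t'j Ft' Ft; rewrite [cell_patch j.+2 K]/= finset.in_set.
apply/existsP; exists tau'; rewrite t'j/=; apply/asboolP.
have [y Dy] : pdom (face_piece F) !=set0 by case: hM => _ [/(_ F)[_ []]].
have Fy : carrier (face_piece F) (pparam (face_piece F) y) by exists y.
exists (pparam (face_piece F) y); split; first exact: face_of_closure Ft _ Fy.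
exact: face_of_closure Ft' _ Fy.
Qed.

Variables (K : cell M) (v : sob R d) (hv : broken_H1 M Omega v).
Hypothesis hsupp : {ae leb, forall x, Omega x -> ~ elt K x -> v.1 x = 0}.
Hypothesis hP : is_P Omega tr T v mu.

(** [v] vanishes almost everywhere on [tau], so there it pairs like the zero function. *)
Lemma pw_const_off_support c tau : tau != K -> pw_const tr c tau v.1 = 0.
Proof.
move=> tK; have Hv : H1 (elt tau) v by case: hv.
pose z : sob R d := (cst 0, cst 0).
have Hz : H1 (elt tau) z by apply: (H1_ae_eq0 (pE tau)) => //; exact: aeW.
rewrite (pw_const_ae_eq hM hfine htr c Hv Hz).
  by rewrite (pw_const_cst hM hfine htr c (a := 0) Hz)// mul0r.
apply: filterS hsupp => x vx tx; apply: vx; first exact: EO tx.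
by move=> Kx; rewrite (elt_disjoint hM tx Kx) eqxx in tK.
Qed.

(* Testing the equation for [P v] with the part of [mu] carried by the faces
   that touch no element of the [j]-th patch. *)
Lemma patch_energy_step j : (0 < j)%N -> 1 <= alph ->
  H1A2 A (~: cell_patch j.+1 K)%SET u <=
  (max_faces M)%:R * alph *
    (H1A2 A (~: cell_patch j K)%SET u - H1A2 A (~: cell_patch j.+1 K)%SET u).
Proof.
move=> j0 a1; pose G F := ~~ [exists tau in cell_patch j K, face_of F tau].
pose nu := cutoff G mu.
have nu_in tau f : tau \in cell_patch j K -> pw_const tr nu tau f = 0.
  move=> tj; rewrite pw_const_cutoff big1// => F /andP[Ft] /existsP[].
  by exists tau; rewrite tj.
have nu_out tau f : tau \notin cell_patch j.+1 K ->
    pw_const tr nu tau f = pw_const tr mu tau f.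
  move=> tj; rewrite pw_const_cutoff pw_const_faces; apply: eq_bigl => F.
  case: (boolP (face_of F tau)) => // Ft; apply/negP => /existsP[t' /andP[t'j Ft']].
  by move/negP : tj; apply; exact: cell_patch_face Ft' Ft.
have [_ hPnu] := hP.
have : pairing (pw_const tr nu) u.1 = 0.
  rewrite hPnu; last exact: (cutoff_tLambda_h_f pO hM hfine htr hA hT).
  (* On [K], which lies in every patch of index at least 1, it is [nu] that vanishes; elsewhere it
     is [v]. *)
  rewrite /pairing big1// => tau _; have [->|] := eqVneq tau K.
    by apply: nu_in; exact: cell_patch_self.
  exact: pw_const_off_support.
pose a := (max_faces M)%:R * alph.
pose E tau := energy A tau u.
pose ind i tau := if tau \in (~: cell_patch i K)%SET then E tau else 0.
have indE i : H1A2 A (~: cell_patch i K)%SET u = \sum_tau ind i tau.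
  by rewrite /H1A2 big_mkcond.
(* All sums now run over the whole mesh, so the claim is compared with the vanishing pairing term by
   term: 0 inside, - a E on the layer, E outside. *)
rewrite !indE -sumrB mulr_sumr -subr_le0 -sumrB => p0; rewrite -[leRHS]p0; apply: ler_sum => tau _.
rewrite /ind !finset.in_setC.
have [tj|tj] := boolP (tau \in cell_patch j K).
  by rewrite (cell_patchS tj)/= nu_in// subrr mulr0 subrr.
have [tj1|tj1] /= := boolP (tau \in cell_patch j.+1 K).
  by rewrite subr0 sub0r; exact: pw_const_cutoff_ge.
by rewrite nu_out// -energy_form_T subrr mulr0 subr0.
Qed.

(** With a = N alpha, the step gives the factor a / (1 + a) = 1 - 1 / (1 + a), which is at most e^(-
    1 / (1 + a)) since 1 - x <= e^(-x). The first patch {K} is only compared with the whole mesh and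
    gains nothing, hence the exponent j for the patch of index j + 1. *)
Lemma patch_energy_decay j : 1 <= alph ->
  H1A2 A (~: cell_patch j.+1 K)%SET u <=
  expR (- (j%:R / (1 + (max_faces M)%:R * alph))) * H1A2 A [set: cell M]%SET u.
Proof.
move=> a1; set a := (max_faces M)%:R * alph.
have a0 : 0 <= a by rewrite mulr_ge0// (le_trans ler01).
have E0 i : 0 <= H1A2 A (~: cell_patch i K)%SET u.
  by apply: sumr_ge0 => tau _; exact: energy_T_ge0.
elim: j => [|j IH].
  rewrite mul0r oppr0 expR0 mul1r /H1A2 big_mkcond [leRHS]big_mkcond.
  apply: ler_sum => tau _; rewrite finset.in_setT; case: ifP => // _.
  exact: energy_T_ge0.
have -> : - (j.+1%:R / (1 + a)) = - (1 + a)^-1 + - (j%:R / (1 + a)) :> R.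
  by rewrite -addn1 natrD; field; rewrite gt_eqF// ltr_pwDl.
rewrite expRD -mulrA; apply: (le_trans _ (ler_wpM2l (expR_ge0 _) IH)).
apply: (@le_trans _ _ ((1 - (1 + a)^-1) * H1A2 A (~: cell_patch j.+1 K)%SET u)); last first.
  by rewrite ler_wpM2r// expR_ge1Dx.
have step := patch_energy_step (ltn0Sn j) a1; rewrite -/a in step.
have -> : 1 - (1 + a)^-1 = a / (1 + a) by field; rewrite gt_eqF// ltr_pwDl.
rewrite mulrAC ler_pdivlMr ?ltr_pwDl//; lra.
Qed.

End decay.

Theorem theorem3 (R : realType) (d : nat) (hd : d = 2%N \/ d = 3%N)
  (Omega : set 'rV[R]_d) (hOmega : polyhedral_domain Omega)
  (A : 'rV[R]_d -> 'M[R]_d) (amin amax : R)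
  (hA : is_coefficient Omega A amin amax)
  (M : mesh R d) (H h rho : R)
  (hM : is_mesh M Omega H)
  (hrho : 0 < rho) (hreg : shape_regular M rho)
  (hh : 0 < h) (hfine : is_submesh M h)
  (tr : cell M -> ('rV[R]_d -> R) -> ('rV[R]_d -> R)) (htr : is_trace tr)
  (T : bdata M -> sob R d) (hT : is_T Omega tr A T)
  (gamma : R) (hgamma : 0 < gamma)
  (halpha : forall (tau : cell M) (F : face M) (c : coefs M),
    face_of F tau -> tLambda_h_f Omega tr c ->
    energy A tau (T (pw_const tr (chi tau F c))) <=
      alpha M A gamma H h * energy A tau (T (pw_const tr c)))
  (K : cell M) (v : sob R d) (hv : broken_H1 M Omega v)
  (hsupp : {ae lebesgue_rV R d, forall x, Omega x -> ~ elt K x -> v.1 x = 0})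
  (mu : coefs M) (hmu : is_P Omega tr T v mu)
  (j : nat) (hj : (1 <= j)%N) :
  H1A2 A (~: cell_patch j.+1 K)%SET (T (pw_const tr mu)) <=
    expR (- (j%:R / (1 + (max_faces M)%:R * alpha M A gamma H h))) *
      H1A2 A [set: cell M]%SET (T (pw_const tr mu)).
Proof.
have [a1|E0] := alpha_ge1_or_energy0 hOmega hM hfine htr hA hT halpha hmu.1.
  exact: (patch_energy_decay hOmega hM hfine htr hA hT halpha hmu.1 hv hsupp hmu).
by rewrite /H1A2 !big1// mulr0.
Qed.
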